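(* Let $(\mathfrak g,\lhd,\mathfrak a)$ be a right Lie module over a field of characteristic zero, with universal envelope $(\mathcal U(\mathfrak g),\lhd,\mathcal U(\mathfrak a))$. The set $G_\Delta$ of all coalgebra morphisms from $\mathcal U(\mathfrak g)$ to $\mathcal U(\mathfrak a)$ is a group for the product $\#$, with unit $\eta_{\mathcal U(\mathfrak a)}\circ\varepsilon_{\mathcal U(\mathfrak g)}$. In particular every element of $G_\Delta$ is invertible in the algebra of linear maps $\mathcal U(\mathfrak g)\to\mathcal U(\mathfrak a)$ equipped with $\#$. Moreover, for every $A\in G_\Delta$, the inverse of $A$ for the convolution product is $$A^{-1^{*}}=\mathcal S_{\mathcal U(\mathfrak a)}\circ A .$$
   Context: A right Lie module $(\mathfrak g,\lhd,\mathfrak a)$: Lie algebras $\mathfrak g,\mathfrak a$ and a bilinear map $\lhd\colon\mathfrak g\times\mathfrak a\to\mathfrak g$ with $[x,y]\lhd a=[x\lhd a,y]+[x,y\lhd a]$ and $x\lhd[a,b]=(x\lhd a)\lhd b-(x\lhd b)\lhd a$. The action extends uniquely to a right action $\lhd$ of the algebra $\mathcal U(\mathfrak a)$ on $\mathcal U(\mathfrak g)$ such that each $a\in\mathfrak a$ acts by the derivation extending $x\mapsto x\lhd a$; then $(XY)\lhd A=(X\lhd A_{(1)})(Y\lhd A_{(2)})$ and $\lhd$ is a coalgebra map $\mathcal U(\mathfrak g)\otimes\mathcal U(\mathfrak a)\to\mathcal U(\mathfrak g)$. Universal enveloping algebras carry their standard cocommutative Hopf structure; $\varepsilon,\eta,\mathcal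 S$ are counit, unit, antipode; Sweedler notation is used. Coalgebra morphisms preserve counits. For linear maps $A,B\colon\mathcal U(\mathfrak g)\to\mathcal U(\mathfrak a)$, the convolution product is $(A*B)(f)=A(f_{(1)})B(f_{(2)})$, and $(A\#B)(f)=A\big(f_{(1)}\lhd\mathcal S_{\mathcal U(\mathfrak a)}(B(f_{(2)})_{(1)})\big)\,B(f_{(2)})_{(2)}$, which is associative. *)

(* Defs.v *)
From HB Require Import structures.
From mathcomp Require Import all_boot all_algebra.
From mathcomp Require Import boolp.
Set Implicit Arguments.
Unset Strict Implicit.
Unset Printing Implicit Defensive.
Import GRing.Theory.
Local Open Scope ring_scope.
Local Open Scope quotient_scope.

HB.mixin Record Lmodule_isLie (k : pzRingType) (L : Type) of GRing.Lmodule k L := {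
  lie : L -> L -> L;
  lie_linearl : forall (c : k) (x y z : L), lie (c *: x + y) z = c *: lie x z + lie y z;
  lie_linearr : forall (c : k) (x y z : L), lie z (c *: x + y) = c *: lie z x + lie z y;
  liexx : forall x : L, lie x x = 0;
  lie_jacobi : forall x y z : L,
    lie x (lie y z) + lie y (lie z x) + lie z (lie x y) = 0
}.
#[short(type="lieAlgType")]
HB.structure Definition LieAlgebra (k : pzRingType) :=
  {L of GRing.Lmodule k L & Lmodule_isLie k L}.
Arguments lie {k s}.

Record rLieModule (k : fieldType) (g a : lieAlgType k) := RLieModule {
  rlact :> {bilinear g -> a -> g};
  rlact_derivation : forall x y u,
    rlact (lie x y) u = lie (rlact x u) y + lie x (rlact y u);
  rlact_bracket : forall x u v,
    rlact x (lie u v) = rlact (rlact x u) v - rlact (rlact x v) u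
}.

HB.instance Definition _ (k : pzRingType) (A : lmodType k) :=
  GRing.Lmodule.copy (A^c)%type A.
Section Converse.
Variables (k : pzRingType) (A : algType k).
Let convAl (c : k) (u v : A^c) : c *: (u * v) = (c *: u : A^c) * v.
Proof. exact: (@scalerAr k A c v u). Qed.
HB.instance Definition _ := GRing.Lmodule_isLalgebra.Build k (A^c)%type convAl.
Let convAr (c : k) (u v : A^c) : c *: (u * v) = u * (c *: v : A^c).
Proof. exact: (@scalerAl k A c v u). Qed.
HB.instance Definition _ := GRing.Lalgebra_isAlgebra.Build k (A^c)%type convAr.
End Converse.

Section Envelope.
Variables (k : fieldType) (g : lieAlgType k).

(* Lie algebra morphisms into an associative unital algebra A with its
   commutator bracket. *)
Definition lie_map (A : algType k) (f : g -> A) : Prop :=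
  linear f /\ forall x y, f (lie x y) = f x * f y - f y * f x.

(* A sequence of pairs (c, [:: x1; ..; xn]) stands for the element
   sum of c x1 ... xn of the tensor algebra of g; word_eval f is its image
   under the algebra morphism extending f. *)
Definition word_eval (A : algType k) (f : g -> A) (s : seq (k * seq g)) : A :=
  \sum_(p <- s) p.1 *: \prod_(x <- p.2) f x.

(* Two elements of the tensor algebra are identified when no Lie morphism into
   an associative algebra separates them, i.e. when they agree modulo the ideal
   generated by the x y - y x - [x, y] (the quotient by that ideal is one of
   the algebras A). The universal property of the resulting algebra env g is
   given by env_gen_lie_map, env_lift_gen, env_lift_linear,
   env_lift_monoid_morphism and env_lift_unique below. *)
Definition env_eq : rel (seq (k * seq g)) := fun s t =>
  `[< forall (A : algType k) (f : g -> A), lie_map f ->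
        word_eval f s = word_eval f t >].

Lemma env_eq_equiv : equiv_class_of env_eq.
Proof.
split=> [s|s t|t s u].
- exact/asboolP.
- by apply/asboolP/asboolP => h A f hf; rewrite h.
- by move=> /asboolP h1 /asboolP h2; apply/asboolP => A f hf; rewrite h1 // h2.
Qed.
Canonical env_equiv := EquivRelPack env_eq_equiv.

Definition env : Type := {eq_quot env_equiv}.
HB.instance Definition _ := Choice.on env.
HB.instance Definition _ := EqQuotient.on env.

(* The extension of f to env g; only meaningful when f is a lie_map, as it is
   computed on a chosen representative. *)
Definition env_lift (A : algType k) (f : g -> A) (X : env) : A :=
  word_eval f (repr X).

Section Eval.
Variables (A : algType k) (f : g -> A).

Lemma word_eval_nil : word_eval f [::] = 0.
Proof. by rewrite /word_eval big_nil. Qed.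

Lemma word_eval_seq1 c w : word_eval f [:: (c, w)] = c *: \prod_(x <- w) f x.
Proof. by rewrite /word_eval big_seq1. Qed.

Lemma word_eval_cat s t : word_eval f (s ++ t) = word_eval f s + word_eval f t.
Proof. by rewrite /word_eval big_cat. Qed.

Lemma word_eval_scale c s :
  word_eval f [seq (c * p.1, p.2) | p <- s] = c *: word_eval f s.
Proof.
rewrite /word_eval big_map scaler_sumr.
by apply: eq_bigr => p _; rewrite /= scalerA.
Qed.

Lemma word_eval_mul s t :
  word_eval f [seq (p.1 * q.1, p.2 ++ q.2) | p <- s, q <- t]
  = word_eval f s * word_eval f t.
Proof.
rewrite /word_eval big_allpairs_dep big_distrl; apply: eq_bigr => p _.
rewrite big_distrr; apply: eq_bigr => q _ /=.
by rewrite big_cat -scalerAl -scalerAr scalerA.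
Qed.

Lemma env_lift_pi s : lie_map f -> env_lift f (\pi_env s) = word_eval f s.
Proof.
move=> hf; rewrite /env_lift.
have: repr (\pi_env s) = s %[mod env] by rewrite reprK.
by move/eqmodP/asboolP; apply.
Qed.

End Eval.

Lemma env_ext (X Y : env) :
  (forall (A : algType k) (f : g -> A), lie_map f ->
     env_lift f X = env_lift f Y) -> X = Y.
Proof.
move=> h; rewrite -[X]reprK -[Y]reprK; apply/eqmodP/asboolP => A f hf.
exact: h.
Qed.

Definition env_zero : env := \pi_env [::].
Definition env_one : env := \pi_env [:: (1, [::])].
Definition env_add (X Y : env) : env := \pi_env (repr X ++ repr Y).
Definition env_scale (c : k) (X : env) : env :=
  \pi_env [seq (c * p.1, p.2) | p <- repr X].
Definition env_opp (X : env) : env := env_scale (- 1) X.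
Definition env_mul (X Y : env) : env :=
  \pi_env [seq (p.1 * q.1, p.2 ++ q.2) | p <- repr X, q <- repr Y].
Definition env_gen (x : g) : env := \pi_env [:: (1, [:: x])].

Section LiftE.
Variables (A : algType k) (f : g -> A) (hf : lie_map f).

Lemma env_lift_zero : env_lift f env_zero = 0.
Proof. by rewrite env_lift_pi // word_eval_nil. Qed.
Lemma env_lift_one : env_lift f env_one = 1.
Proof. by rewrite env_lift_pi // word_eval_seq1 big_nil scale1r. Qed.
Lemma env_lift_add X Y : env_lift f (env_add X Y) = env_lift f X + env_lift f Y.
Proof. by rewrite env_lift_pi // word_eval_cat. Qed.
Lemma env_lift_scale c X : env_lift f (env_scale c X) = c *: env_lift f X.
Proof. by rewrite env_lift_pi // word_eval_scale. Qed.
Lemma env_lift_opp X : env_lift f (env_opp X) = - env_lift f X.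
Proof. by rewrite env_lift_scale scaleN1r. Qed.
Lemma env_lift_mul X Y : env_lift f (env_mul X Y) = env_lift f X * env_lift f Y.
Proof. by rewrite env_lift_pi // word_eval_mul. Qed.
Lemma env_lift_gen x : env_lift f (env_gen x) = f x.
Proof. by rewrite env_lift_pi // word_eval_seq1 big_seq1 scale1r. Qed.

Definition env_liftE :=
  (env_lift_zero, env_lift_one, env_lift_add, env_lift_opp, env_lift_scale,
   env_lift_mul, env_lift_gen).
End LiftE.

Lemma env_addA : associative env_add.
Proof. by move=> X Y Z; apply: env_ext => A f hf; rewrite !(env_liftE hf) addrA. Qed.
Lemma env_addC : commutative env_add.
Proof. by move=> X Y; apply: env_ext => A f hf; rewrite !(env_liftE hf) addrC. Qed.
Lemma env_add0 : left_id env_zero env_add.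
Proof. by move=> X; apply: env_ext => A f hf; rewrite !(env_liftE hf) add0r. Qed.
Lemma env_addN : left_inverse env_zero env_opp env_add.
Proof. by move=> X; apply: env_ext => A f hf; rewrite !(env_liftE hf) addNr. Qed.
HB.instance Definition _ :=
  GRing.isZmodule.Build env env_addA env_addC env_add0 env_addN.

Lemma env_scaleA (b c : k) X : env_scale b (env_scale c X) = env_scale (b * c) X.
Proof. by apply: env_ext => A f hf; rewrite !(env_liftE hf) scalerA. Qed.
Lemma env_scale1 : left_id 1 env_scale.
Proof. by move=> X; apply: env_ext => A f hf; rewrite !(env_liftE hf) scale1r. Qed.
Lemma env_scaleDr : right_distributive env_scale +%R.
Proof. by move=> c X Y; apply: env_ext => A f hf; rewrite !(env_liftE hf) scalerDr. Qed.
Lemma env_scaleDl X : {morph env_scale^~ X : b c / b + c}.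
Proof. by move=> b c; apply: env_ext => A f hf; rewrite !(env_liftE hf) scalerDl. Qed.
HB.instance Definition _ :=
  GRing.Zmodule_isLmodule.Build k env env_scaleA env_scale1 env_scaleDr env_scaleDl.

Lemma env_mulA : associative env_mul.
Proof. by move=> X Y Z; apply: env_ext => A f hf; rewrite !(env_liftE hf) mulrA. Qed.
Lemma env_mul1l : left_id env_one env_mul.
Proof. by move=> X; apply: env_ext => A f hf; rewrite !(env_liftE hf) mul1r. Qed.
Lemma env_mul1r : right_id env_one env_mul.
Proof. by move=> X; apply: env_ext => A f hf; rewrite !(env_liftE hf) mulr1. Qed.
Lemma env_mulDl : left_distributive env_mul +%R.
Proof. by move=> X Y Z; apply: env_ext => A f hf; rewrite !(env_liftE hf) mulrDl. Qed.
Lemma env_mulDr : right_distributive env_mul +%R.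
Proof. by move=> X Y Z; apply: env_ext => A f hf; rewrite !(env_liftE hf) mulrDr. Qed.

Lemma lie_map0 (A : comAlgType k) : lie_map (fun _ : g => 0 : A).
Proof. by split=> [c x y|x y]; rewrite ?scaler0 ?mulr0 ?subr0 ?addr0. Qed.

Definition counit (X : env) : k := env_lift (fun _ : g => 0 : k^o) X.

Lemma env_one_neq0 : env_one != 0.
Proof.
apply/eqP => /(congr1 counit); rewrite /counit.
have h : lie_map (fun _ : g => 0 : k^o) by exact: lie_map0.
rewrite (env_lift_one h) [X in _ = X](env_lift_zero h).
by apply/eqP; rewrite oner_neq0.
Qed.
HB.instance Definition _ :=
  GRing.Zmodule_isNzRing.Build env env_mulA env_mul1l env_mul1r env_mulDl env_mulDr env_one_neq0.
Lemma env_scaleAl (c : k) (X Y : env) : c *: (X * Y) = (c *: X) * Y.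
Proof. by apply: env_ext => A f hf; rewrite !(env_liftE hf) scalerAl. Qed.
HB.instance Definition _ := GRing.Lmodule_isLalgebra.Build k env env_scaleAl.
Lemma env_scaleAr (c : k) (X Y : env) : c *: (X * Y) = X * (c *: Y).
Proof. by apply: env_ext => A f hf; rewrite !(env_liftE hf) scalerAr. Qed.
HB.instance Definition _ := GRing.Lalgebra_isAlgebra.Build k env env_scaleAr.

End Envelope.

Section EnvelopeTheory.
Variables (k : fieldType) (g : lieAlgType k).
Notation U := (env g).

Lemma env_lift_linear (A : algType k) (f : g -> A) :
  lie_map f -> linear (env_lift f).
Proof. by move=> hf c X Y; rewrite (env_lift_add hf) (env_lift_scale hf). Qed.

Lemma env_lift_monoid_morphism (A : algType k) (f : g -> A) :
  lie_map f -> monoid_morphism (env_lift f).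
Proof.
move=> hf; split; first exact: env_lift_one.
by move=> X Y; rewrite (env_lift_mul hf).
Qed.

Lemma env_gen_lie_map : lie_map (@env_gen k g).
Proof.
split=> [c x y|x y]; apply: env_ext => A f hf; have [hl hb] := hf.
  rewrite (env_lift_linear hf) !(env_lift_gen hf); exact: hl.
rewrite -scaleN1r addrC (env_lift_linear hf) scaleN1r addrC.
by rewrite !(env_lift_mul hf) !(env_lift_gen hf).
Qed.

Lemma env_decomp (X : U) : X = word_eval (@env_gen k g) (repr X).
Proof.
apply: env_ext => A f hf; rewrite {1}/env_lift /word_eval.
pose phi : U -> A := env_lift f.
have phi0 : phi 0 = 0 by apply: env_lift_zero.
rewrite -/(phi (\sum_(p <- _) _)) (big_morph phi (env_lift_add hf) phi0).
apply: eq_bigr => p _; rewrite [RHS](env_lift_scale hf); congr (_ *: _).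
rewrite -/(phi (\prod_(x <- _) _)).
rewrite (big_morph phi (env_lift_mul hf) (env_lift_one hf)).
by apply: eq_bigr => x _; rewrite /phi env_lift_gen.
Qed.

Lemma env_ind (P : U -> Prop) :
  P 1 -> (forall x X, P X -> P (env_gen x * X)) ->
  (forall c X Y, P X -> P Y -> P (c *: X + Y)) -> forall X, P X.
Proof.
move=> h1 hM hL X; rewrite [X]env_decomp /word_eval.
have h0 : P 0 by have := hL (-1) _ _ h1 h1; rewrite scaleN1r addNr.
elim: (repr X) => [|p s IH]; first by rewrite big_nil.
rewrite big_cons; apply: hL => //.
elim: p.2 => [|x w IHw]; first by rewrite big_nil.
by rewrite big_cons; apply: hM.
Qed.

Lemma env_lift_unique (A : algType k) (f : g -> A) (phi : U -> A) :
  lie_map f -> linear phi -> monoid_morphism phi ->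
  (forall x, phi (env_gen x) = f x) -> phi =1 env_lift f.
Proof.
move=> hf hl [h1 hM] hg; apply: env_ind.
- by rewrite h1 [RHS](env_lift_one hf).
- by move=> x X IH; rewrite hM [RHS](env_lift_mul hf) hg IH env_lift_gen.
- by move=> c X Y hX hY; rewrite hl hX hY (env_lift_linear hf).
Qed.

Lemma counit_lie_map : lie_map (fun _ : g => 0 : k^o).
Proof. exact: lie_map0. Qed.

HB.instance Definition _ := GRing.isLinear.Build k U k *%R (@counit k g)
  (env_lift_linear counit_lie_map).
HB.instance Definition _ := GRing.isMonoidMorphism.Build U k (@counit k g)
  (env_lift_monoid_morphism counit_lie_map).

Lemma counit_gen (x : g) : counit (env_gen x) = 0 :> k.
Proof. exact: (env_lift_gen counit_lie_map). Qed.

(* The anti-morphism of algebras with x |-> - x on g. *)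
Definition antipode (X : U) : U :=
  env_lift (fun x => - env_gen x : U^c) X.

Lemma antipode_lie_map : lie_map (fun x => - env_gen x : U^c).
Proof.
have [hl hb] := env_gen_lie_map.
split=> [c x y|x y]; first by rewrite hl opprD -scalerN.
rewrite hb opprB [in RHS]/GRing.mul /=.
by rewrite !mulrNN.
Qed.

HB.instance Definition _ := GRing.isLinear.Build k U U *:%R antipode
  (env_lift_linear antipode_lie_map).

Lemma antipode_gen (x : g) : antipode (env_gen x) = - env_gen x.
Proof. exact: (env_lift_gen antipode_lie_map). Qed.
Lemma antipode1 : antipode 1 = 1.
Proof. exact: (env_lift_one antipode_lie_map). Qed.
Lemma antipodeM X Y : antipode (X * Y) = antipode Y * antipode X.
Proof. exact: (env_lift_mul antipode_lie_map). Qed.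

End EnvelopeTheory.
Arguments antipode {k g} X.
Arguments counit {k g} X.
Arguments env_gen {k g} x.

Section Tensor.
Variables (k : fieldType) (U V : lmodType k).
Implicit Types (W : lmodType k).

Definition formal_eval W (b : U -> V -> W) (s : seq (U * V)) : W :=
  \sum_(p <- s) b p.1 p.2.

(* Formal sums of pairs, modulo agreement under all bilinear maps: this is the
   tensor product; its universal property is given by pure_bilinear,
   tens_lift_pure, tens_lift_linear and tens_lift_unique below. *)
Definition tens_eq : rel (seq (U * V)) := fun s t =>
  `[< forall W (b : U -> V -> W), bilinear_for *:%R *:%R b ->
        formal_eval b s = formal_eval b t >].

Lemma tens_eq_equiv : equiv_class_of tens_eq.
Proof.
split=> [s|s t|t s u].
- exact/asboolP.
- by apply/asboolP/asboolP => h W b hb; rewrite h.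
- by move=> /asboolP h1 /asboolP h2; apply/asboolP => W b hb; rewrite h1 // h2.
Qed.
Canonical tens_equiv := EquivRelPack tens_eq_equiv.

Definition tens : Type := {eq_quot tens_equiv}.
HB.instance Definition _ := Choice.on tens.
HB.instance Definition _ := EqQuotient.on tens.

(* The linear map on U (x) V induced by b; only meaningful for b bilinear. *)
Definition tens_lift W (b : U -> V -> W) (t : tens) : W :=
  formal_eval b (repr t).

Lemma tens_lift_pi W (b : U -> V -> W) s :
  bilinear_for *:%R *:%R b -> tens_lift b (\pi_tens s) = formal_eval b s.
Proof.
move=> hb; rewrite /tens_lift.
have: repr (\pi_tens s) = s %[mod tens] by rewrite reprK.
by move/eqmodP/asboolP; apply.
Qed.

Lemma tens_ext (s t : tens) :
  (forall W (b : U -> V -> W), bilinear_for *:%R *:%R b ->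
     tens_lift b s = tens_lift b t) -> s = t.
Proof.
move=> h; rewrite -[s]reprK -[t]reprK; apply/eqmodP/asboolP => W b hb.
exact: h.
Qed.

Definition pure (u : U) (v : V) : tens := \pi_tens [:: (u, v)].
Definition tens_zero : tens := \pi_tens [::].
Definition tens_add (s t : tens) : tens := \pi_tens (repr s ++ repr t).
Definition tens_scale (c : k) (t : tens) : tens :=
  \pi_tens [seq (c *: p.1, p.2) | p <- repr t].
Definition tens_opp (t : tens) : tens := tens_scale (- 1) t.

Section LiftE.
Variables (W : lmodType k) (b : U -> V -> W) (hb : bilinear_for *:%R *:%R b).

Lemma tens_lift_pure u v : tens_lift b (pure u v) = b u v.
Proof. by rewrite tens_lift_pi // /formal_eval big_seq1. Qed.
Lemma tens_lift_zero : tens_lift b tens_zero = 0.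
Proof. by rewrite tens_lift_pi // /formal_eval big_nil. Qed.
Lemma tens_lift_add s t :
  tens_lift b (tens_add s t) = tens_lift b s + tens_lift b t.
Proof. by rewrite tens_lift_pi // /formal_eval big_cat. Qed.
Lemma tens_lift_scale c t : tens_lift b (tens_scale c t) = c *: tens_lift b t.
Proof.
rewrite tens_lift_pi // /tens_lift /formal_eval big_map scaler_sumr.
apply: eq_bigr => p _; exact: (scalable_linear (hb.1 p.2)).
Qed.
Lemma tens_lift_opp t : tens_lift b (tens_opp t) = - tens_lift b t.
Proof. by rewrite tens_lift_scale scaleN1r. Qed.
Definition tens_liftE := (tens_lift_pure, tens_lift_zero, tens_lift_add,
  tens_lift_opp, tens_lift_scale).
End LiftE.

Lemma tens_addA : associative tens_add.
Proof. by move=> x y z; apply: tens_ext => W b hb; rewrite !(tens_liftE hb) addrA. Qed.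
Lemma tens_addC : commutative tens_add.
Proof. by move=> x y; apply: tens_ext => W b hb; rewrite !(tens_liftE hb) addrC. Qed.
Lemma tens_add0 : left_id tens_zero tens_add.
Proof. by move=> x; apply: tens_ext => W b hb; rewrite !(tens_liftE hb) add0r. Qed.
Lemma tens_addN : left_inverse tens_zero tens_opp tens_add.
Proof. by move=> x; apply: tens_ext => W b hb; rewrite !(tens_liftE hb) addNr. Qed.
HB.instance Definition _ :=
  GRing.isZmodule.Build tens tens_addA tens_addC tens_add0 tens_addN.

Lemma tens_scaleA (c d : k) x : tens_scale c (tens_scale d x) = tens_scale (c * d) x.
Proof. by apply: tens_ext => W b hb; rewrite !(tens_liftE hb) scalerA. Qed.
Lemma tens_scale1 : left_id 1 tens_scale.
Proof. by move=> x; apply: tens_ext => W b hb; rewrite !(tens_liftE hb) scale1r. Qed.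
Lemma tens_scaleDr : right_distributive tens_scale +%R.
Proof. by move=> c x y; apply: tens_ext => W b hb; rewrite !(tens_liftE hb) scalerDr. Qed.
Lemma tens_scaleDl x : {morph tens_scale^~ x : c d / c + d}.
Proof. by move=> c d; apply: tens_ext => W b hb; rewrite !(tens_liftE hb) scalerDl. Qed.
HB.instance Definition _ :=
  GRing.Zmodule_isLmodule.Build k tens tens_scaleA tens_scale1 tens_scaleDr tens_scaleDl.

Lemma tens_lift_linear W (b : U -> V -> W) :
  bilinear_for *:%R *:%R b -> linear (tens_lift b).
Proof. by move=> hb c x y; rewrite (tens_lift_add hb) (tens_lift_scale hb). Qed.

Lemma pure_bilinear : bilinear_for *:%R *:%R pure.
Proof.
by split=> [v c x y|u c x y]; apply: tens_ext => W b hb;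
   rewrite (tens_lift_linear hb) !(tens_lift_pure hb); [apply: hb.1 | apply: hb.2].
Qed.

Lemma tens_ind (P : tens -> Prop) :
  P 0 -> (forall u v t, P t -> P (pure u v + t)) -> forall t, P t.
Proof.
move=> h0 hD t; have -> : t = formal_eval pure (repr t).
  apply: tens_ext => W b hb; rewrite {1}/tens_lift /formal_eval.
  rewrite (big_morph (tens_lift b) (tens_lift_add hb) (tens_lift_zero hb)).
  by apply: eq_bigr => p _; rewrite tens_lift_pure.
rewrite /formal_eval; elim: (repr t) => [|p s IH]; first by rewrite big_nil.
by rewrite big_cons; apply: hD.
Qed.

Lemma tens_lift_unique W (b : U -> V -> W) (phi : tens -> W) :
  bilinear_for *:%R *:%R b -> linear phi ->
  (forall u v, phi (pure u v) = b u v) -> phi =1 tens_lift b.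
Proof.
move=> hb hl hp; have hD x y : phi (x + y) = phi x + phi y.
  by have := hl 1 x y; rewrite !scale1r.
apply: tens_ind.
  rewrite (tens_lift_zero hb); apply: (addIr (phi 0)).
  by rewrite -hD !add0r.
by move=> u v t IH; rewrite hD hp IH [RHS](tens_lift_add hb) tens_lift_pure.
Qed.

End Tensor.

Notation "u \ox v" := (pure u v) (at level 40, left associativity) : ring_scope.
(* Sweedler notation: F summed over a decomposition of t as a sum of
   pure tensors u \ox v. *)
Notation "\sw_ ( u , v <- t ) F" := (tens_lift (fun u v => F) t)
  (at level 41, F at level 41, u name, v name,
   format "\sw_ ( u ,  v  <-  t )  F") : ring_scope.

Section TensorAlgebra.
Variables (k : fieldType) (A B : algType k).
Notation T := (tens A B).

Definition tens_mul (s t : T) : T :=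
  \sw_(a, b <- s) \sw_(c, d <- t) (a * c) \ox (b * d).

Let inner_bil (a : A) (b : B) :
  bilinear_for *:%R *:%R (fun c d => (a * c) \ox (b * d)).
Proof.
have [hl hr] := pure_bilinear A B.
split=> [d z x y|c z x y] /=.
  by rewrite mulrDr -scalerAr hl.
by rewrite mulrDr -scalerAr hr.
Qed.

Let outer_bil (t : T) :
  bilinear_for *:%R *:%R (fun a b => \sw_(c, d <- t) (a * c) \ox (b * d)).
Proof.
have [hl hr] := pure_bilinear A B.
split=> [b z x y|a z x y] /=.
  rewrite /tens_lift /formal_eval scaler_sumr -big_split /=.
  by apply: eq_bigr => p _; rewrite mulrDl -scalerAl hl.
rewrite /tens_lift /formal_eval scaler_sumr -big_split /=.
by apply: eq_bigr => p _; rewrite mulrDl -scalerAl hr.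
Qed.

Lemma tens_mul_pure a b c d :
  tens_mul (a \ox b) (c \ox d) = (a * c) \ox (b * d).
Proof. by rewrite /tens_mul (tens_lift_pure (outer_bil _)) (tens_lift_pure (inner_bil _ _)). Qed.

Lemma tens_mul_linearl t : linear (tens_mul^~ t).
Proof. exact: tens_lift_linear (outer_bil t). Qed.

Lemma tens_mul_linearr s : linear (tens_mul s).
Proof.
move=> z x y; rewrite /tens_mul {1 2 3}/tens_lift /formal_eval.
rewrite scaler_sumr -big_split /=; apply: eq_bigr => p _.
exact: tens_lift_linear (inner_bil _ _) _ _ _.
Qed.

Lemma tens_mulDl : left_distributive tens_mul +%R.
Proof. by move=> x y t; have := tens_mul_linearl t 1 x y; rewrite !scale1r. Qed.
Lemma tens_mulDr : right_distributive tens_mul +%R.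
Proof. by move=> s x y; have := tens_mul_linearr s 1 x y; rewrite !scale1r. Qed.
Let mul0t t : tens_mul 0 t = 0.
Proof. by apply: (addIr (tens_mul 0 t)); rewrite -tens_mulDl !add0r. Qed.
Let mult0 t : tens_mul t 0 = 0.
Proof. by apply: (addIr (tens_mul t 0)); rewrite -tens_mulDr !add0r. Qed.

Lemma tens_mulA : associative tens_mul.
Proof.
move=> x y z; elim/tens_ind: x => [|a b x IHx]; first by rewrite !mul0t.
rewrite !tens_mulDl {}IHx; congr (_ + _).
elim/tens_ind: y => [|c d y IHy]; first by rewrite !(mul0t, mult0).
rewrite !(tens_mulDl, tens_mulDr) {}IHy; congr (_ + _).
elim/tens_ind: z => [|e f z IHz]; first by rewrite !mult0.
by rewrite !tens_mulDr {}IHz !tens_mul_pure !mulrA.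
Qed.
Lemma tens_mul1l : left_id (1 \ox 1) tens_mul.
Proof.
elim/tens_ind => [|a b x IHx]; first by rewrite mult0.
by rewrite tens_mulDr IHx tens_mul_pure !mul1r.
Qed.
Lemma tens_mul1r : right_id (1 \ox 1) tens_mul.
Proof.
elim/tens_ind => [|a b x IHx]; first by rewrite mul0t.
by rewrite tens_mulDl IHx tens_mul_pure !mulr1.
Qed.
HB.instance Definition _ := GRing.Zmodule_isPzRing.Build T
  tens_mulA tens_mul1l tens_mul1r tens_mulDl tens_mulDr.

Lemma tens_scaleAl (c : k) (x y : T) : c *: (x * y) = (c *: x) * y.
Proof. by have := tens_mul_linearl y c x 0; rewrite mul0t !addr0. Qed.
Lemma tens_scaleAr (c : k) (x y : T) : c *: (x * y) = x * (c *: y).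
Proof. by have := tens_mul_linearr x c y 0; rewrite mult0 !addr0. Qed.

End TensorAlgebra.

Section EnvTensor.
Variables (k : fieldType) (g h : lieAlgType k).
Notation T := (tens (env g) (env h)).

Lemma tens_env_one_neq0 : (1 : T) != 0.
Proof.
pose b (X : env g) (Y : env h) : k^o := counit X * counit Y.
have hb : bilinear_for *:%R *:%R b.
  split=> [Y c X X'|X c Y Y'] /=; rewrite /b linearP.
    by rewrite mulrDl -mulrA.
  by rewrite mulrDr mulrCA.
apply/eqP => /(congr1 (tens_lift b)).
rewrite (tens_lift_zero hb) (tens_lift_pure hb) /b !rmorph1 mulr1.
by apply/eqP/oner_neq0.
Qed.
HB.instance Definition _ := GRing.PzSemiRing_isNonZero.Build T tens_env_one_neq0.
HB.instance Definition _ := GRing.Lmodule_isLalgebra.Build k T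
  (@tens_scaleAl k (env g) (env h)).
HB.instance Definition _ := GRing.Lalgebra_isAlgebra.Build k T
  (@tens_scaleAr k (env g) (env h)).
End EnvTensor.

Lemma sub_cross_terms (V : zmodType) (p q r s m n : V) :
  p - q + (r - s) = p + m + (n + r) - (q + n + (m + s)).
Proof.
rewrite (addrC n r) (addrACA p m) (addrC m s) (addrACA q n) (addrC n m).
by rewrite opprD (addrACA (p + r)) subrr addr0 opprD (addrACA p r).
Qed.

Section Coproduct.
Variables (k : fieldType) (g : lieAlgType k).
Notation U := (env g).

Definition coprod (X : U) : tens U U :=
  env_lift (fun x => env_gen x \ox 1 + 1 \ox env_gen x) X.

Lemma coprod_lie_map :
  lie_map (fun x : g => env_gen x \ox 1 + 1 \ox env_gen x : tens U U).
Proof.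
have [hl hb] := env_gen_lie_map g; have [pl pr] := pure_bilinear U U.
split=> [c x y|x y].
  by rewrite hl pl pr scalerDr addrACA.
have E (a b c d : U) : (a \ox b) * (c \ox d) = (a * c) \ox (b * d).
  exact: tens_mul_pure.
rewrite !mulrDl !mulrDr !E !mulr1 !mul1r hb.
have Bl (a b c : U) : (a - b) \ox c = a \ox c - b \ox c.
  by rewrite -(scaleN1r b) addrC pl /= scaleN1r addrC.
have Br (a b c : U) : c \ox (a - b) = c \ox a - c \ox b.
  by rewrite -(scaleN1r b) addrC pr /= scaleN1r addrC.
rewrite Bl Br; exact: sub_cross_terms.
Qed.

HB.instance Definition _ := GRing.isLinear.Build k U (tens U U) *:%R coprod
  (env_lift_linear coprod_lie_map).
HB.instance Definition _ := GRing.isMonoidMorphism.Build U (tens U U) coprod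
  (env_lift_monoid_morphism coprod_lie_map).

Lemma coprod_gen (x : g) :
  coprod (env_gen x) = env_gen x \ox 1 + 1 \ox env_gen x.
Proof. exact: (env_lift_gen coprod_lie_map). Qed.

End Coproduct.
Arguments coprod {k g} X.

Section DualNumbers.
Variables (k : fieldType) (A : algType k).

(* A[e]/(e^2): morphisms X |-> X + D(X) e are the same as derivations D. *)
Definition dual : Type := (A * A)%type.
HB.instance Definition _ := GRing.Lmodule.copy dual (A * A)%type.

Lemma dual_ext (x y : dual) : x.1 = y.1 -> x.2 = y.2 -> x = y.
Proof. by case: x y => [? ?] [? ?] /= -> ->. Qed.

Definition dual_one : dual := (1, 0).
Definition dual_mul (x y : dual) : dual := (x.1 * y.1, x.1 * y.2 + x.2 * y.1).

Lemma dual_mulA : associative dual_mul.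
Proof. by move=> x y z; apply: dual_ext => /=; [|rewrite mulrDl mulrDr]; rewrite !mulrA // addrA. Qed.
Lemma dual_mul1l : left_id dual_one dual_mul.
Proof. by case=> x y; rewrite /dual_mul /= !mul1r mul0r addr0. Qed.
Lemma dual_mul1r : right_id dual_one dual_mul.
Proof. by case=> x y; rewrite /dual_mul /= !mulr1 mulr0 add0r. Qed.
Lemma dual_mulDl : left_distributive dual_mul +%R.
Proof. by move=> x y z; apply: dual_ext => /=; rewrite !mulrDl // addrACA. Qed.
Lemma dual_mulDr : right_distributive dual_mul +%R.
Proof. by move=> x y z; apply: dual_ext => /=; rewrite !mulrDr // addrACA. Qed.
Lemma dual_one_neq0 : dual_one != 0.
Proof. by apply/eqP => -[] /eqP; rewrite oner_eq0. Qed.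
HB.instance Definition _ := GRing.Zmodule_isNzRing.Build dual
  dual_mulA dual_mul1l dual_mul1r dual_mulDl dual_mulDr dual_one_neq0.
Lemma dual_scaleAl (c : k) (x y : dual) : c *: (x * y) = (c *: x : dual) * y.
Proof.
have e : c *: (x.1 * y.2 + x.2 * y.1) = (c *: x.1) * y.2 + (c *: x.2) * y.1.
  by rewrite scalerDr !scalerAl.
apply: dual_ext; [exact: scalerAl | exact: e].
Qed.
HB.instance Definition _ := GRing.Lmodule_isLalgebra.Build k dual dual_scaleAl.
Lemma dual_scaleAr (c : k) (x y : dual) : c *: (x * y) = x * (c *: y : dual).
Proof.
have e : c *: (x.1 * y.2 + x.2 * y.1) = x.1 * (c *: y.2) + x.2 * (c *: y.1).
  by rewrite scalerDr !scalerAr.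
apply: dual_ext; [exact: scalerAr | exact: e].
Qed.
HB.instance Definition _ := GRing.Lalgebra_isAlgebra.Build k dual dual_scaleAr.
End DualNumbers.

Lemma linear_ext (k : fieldType) (U V : lmodType k) (f1 f2 : {linear U -> V}) :
  f1 =1 f2 -> f1 = f2.
Proof.
case: f1 f2 => [f [[A1] [A2]]] [f' [[B1] [B2]]] /= /funext e.
subst f'.
by rewrite (Prop_irrelevance A1 B1) (Prop_irrelevance A2 B2).
Qed.

Section RightEndomorphisms.
Variables (k : fieldType) (A : algType k).

(* Linear endomorphisms with the product f * g = g \o f, so that a right module
   structure is an algebra morphism into rendo. *)
Definition rendo : Type := {linear A -> A}.
HB.instance Definition _ := gen_eqMixin rendo.
HB.instance Definition _ := gen_choiceMixin rendo.
Implicit Types f g h : rendo.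

Definition rendo_zero : rendo := \0%R : {linear A -> A}.
Definition rendo_add f g : rendo := f \+ g : {linear A -> A}.
Definition rendo_scale (c : k) f : rendo := c \*: f : {linear A -> A}.
Definition rendo_opp f : rendo := \- f : {linear A -> A}.
Definition rendo_one : rendo := idfun : {linear A -> A}.
Definition rendo_mul f g : rendo := g \o f : {linear A -> A}.

Lemma rendo_addA : associative rendo_add.
Proof. by move=> f g h; apply: linear_ext => x /=; rewrite addrA. Qed.
Lemma rendo_addC : commutative rendo_add.
Proof. by move=> f g; apply: linear_ext => x /=; rewrite addrC. Qed.
Lemma rendo_add0 : left_id rendo_zero rendo_add.
Proof. by move=> f; apply: linear_ext => x /=; rewrite add0r. Qed.
Lemma rendo_addN : left_inverse rendo_zero rendo_opp rendo_add.
Proof. by move=> f; apply: linear_ext => x /=; rewrite addNr. Qed.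
HB.instance Definition _ :=
  GRing.isZmodule.Build rendo rendo_addA rendo_addC rendo_add0 rendo_addN.

Lemma rendo_scaleA (c d : k) f : rendo_scale c (rendo_scale d f) = rendo_scale (c * d) f.
Proof. by apply: linear_ext => x /=; rewrite scalerA. Qed.
Lemma rendo_scale1 : left_id 1 rendo_scale.
Proof. by move=> f; apply: linear_ext => x /=; rewrite scale1r. Qed.
Lemma rendo_scaleDr : right_distributive rendo_scale +%R.
Proof. by move=> c f g; apply: linear_ext => x /=; rewrite scalerDr. Qed.
Lemma rendo_scaleDl f : {morph rendo_scale^~ f : c d / c + d}.
Proof. by move=> c d; apply: linear_ext => x /=; rewrite scalerDl. Qed.
HB.instance Definition _ := GRing.Zmodule_isLmodule.Build k rendo
  rendo_scaleA rendo_scale1 rendo_scaleDr rendo_scaleDl.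

Lemma rendo_mulA : associative rendo_mul.
Proof. by move=> f g h; apply: linear_ext. Qed.
Lemma rendo_mul1l : left_id rendo_one rendo_mul.
Proof. by move=> f; apply: linear_ext. Qed.
Lemma rendo_mul1r : right_id rendo_one rendo_mul.
Proof. by move=> f; apply: linear_ext. Qed.
Lemma rendo_mulDl : left_distributive rendo_mul +%R.
Proof. by move=> f g h; apply: linear_ext => x /=; rewrite linearD. Qed.
Lemma rendo_mulDr : right_distributive rendo_mul +%R.
Proof. by move=> f g h; apply: linear_ext. Qed.
Lemma rendo_one_neq0 : rendo_one != 0.
Proof.
apply/eqP => /(congr1 (fun f : {linear A -> A} => f 1)) /= /eqP.
by rewrite oner_eq0.
Qed.
HB.instance Definition _ := GRing.Zmodule_isNzRing.Build rendo
  rendo_mulA rendo_mul1l rendo_mul1r rendo_mulDl rendo_mulDr rendo_one_neq0.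
Lemma rendo_scaleAl (c : k) f g : c *: (f * g) = (c *: f) * g.
Proof. by apply: linear_ext => x /=; rewrite linearZ. Qed.
HB.instance Definition _ := GRing.Lmodule_isLalgebra.Build k rendo rendo_scaleAl.
Lemma rendo_scaleAr (c : k) f g : c *: (f * g) = f * (c *: g).
Proof. by apply: linear_ext. Qed.
HB.instance Definition _ := GRing.Lalgebra_isAlgebra.Build k rendo rendo_scaleAr.

Definition rendo_app (f : rendo) (x : A) : A := (f : {linear A -> A}) x.

End RightEndomorphisms.

Section Action.
Variables (k : fieldType) (g a : lieAlgType k) (M : rLieModule g a).
Notation Ug := (env g).
Notation Ua := (env a).

(* The derivation of env g extending x |-> x <| u. *)
Definition der (u : a) (X : Ug) : Ug :=
  (env_lift (fun x => (env_gen x, env_gen (M x u)) : dual Ug) X).2.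

Lemma der_lie_map u :
  lie_map (fun x => (env_gen x, env_gen (M x u)) : dual Ug).
Proof.
have [hl hb] := env_gen_lie_map g.
have hD x y : env_gen (x + y) = env_gen x + env_gen y :> Ug.
  by have := hl 1 x y; rewrite !scale1r.
split=> [c x y|x y].
  apply: dual_ext => /=; first exact: hl.
  rewrite linearPl; exact: hl.
apply: dual_ext; first exact: hb.
have e : env_gen (M (lie x y) u) =
    env_gen x * env_gen (M y u) + env_gen (M x u) * env_gen y
    - (env_gen y * env_gen (M x u) + env_gen (M y u) * env_gen x) :> Ug.
  rewrite rlact_derivation hD !hb opprD addrACA; congr (_ + _).
  exact: addrC.
exact: e.
Qed.

Lemma der_linear u : linear (der u).
Proof. by move=> c X Y; rewrite /der (env_lift_linear (der_lie_map u)). Qed.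
HB.instance Definition _ u :=
  GRing.isLinear.Build k Ug Ug *:%R (der u) (der_linear u).

Lemma der_gen u (x : g) : der u (env_gen x) = env_gen (M x u).
Proof. by rewrite /der (env_lift_gen (der_lie_map u)). Qed.

Lemma der1 u : der u 1 = 0.
Proof. by rewrite /der (env_lift_one (der_lie_map u)). Qed.

Lemma derM u X Y : der u (X * Y) = der u X * Y + X * der u Y.
Proof.
have h1 Z : (env_lift (fun x => (env_gen x, env_gen (M x u)) : dual Ug) Z).1 = Z.
  elim/env_ind: Z => [|x Z IH|c Z Z' IH IH'].
  - by rewrite (env_lift_one (der_lie_map u)).
  - by rewrite (env_lift_mul (der_lie_map u)) (env_lift_gen (der_lie_map u)) /= IH.
  - by rewrite (env_lift_linear (der_lie_map u)) /= IH IH'.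
by rewrite {1}/der (env_lift_mul (der_lie_map u)) /= !h1 addrC.
Qed.

Definition der_rendo (u : a) : rendo Ug := der u : {linear Ug -> Ug}.

Lemma der_rendo_lie_map : lie_map der_rendo.
Proof.
have [hl hb] := env_gen_lie_map g.
split=> [c u v|u v]; apply: linear_ext; apply: env_ind => /=.
- by rewrite !der1 scaler0 addr0.
- move=> x X IH; rewrite !derM !der_gen IH linearPr hl mulrDr mulrDl.
  by rewrite scalerDr -scalerAl -scalerAr addrACA.
- move=> b X Y IH1 IH2; rewrite !der_linear IH1 IH2 !scalerDr !scalerA.
  by rewrite addrACA (mulrC b).
- have d0 w : der w 0 = 0 by exact: linear0.
  by rewrite !der1 !d0 subr0.
- have derD w : {morph der w : X Y / X + Y} by exact: linearD.
  move=> x X IH; rewrite !(derM, der_gen, derD) IH rlact_bracket.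
  set A := M _ v; set B := M _ u.
  have -> : env_gen (A - B) = env_gen A - env_gen B :> Ug.
    by rewrite -(scaleN1r B) addrC hl scaleN1r addrC.
  by rewrite mulrBl mulrBr; apply: sub_cross_terms.
- move=> b X Y IH1 IH2; rewrite !der_linear IH1 IH2.
  by rewrite scalerBr opprD addrACA.
Qed.

(* The right action of env a on env g; act_unique shows that it is the only
   one extending M for which elements of a act by derivations. *)
Definition act (X : Ug) (A : Ua) : Ug := rendo_app (env_lift der_rendo A) X.

Lemma act_bilinear : bilinear_for *:%R *:%R act.
Proof.
split=> [A c X Y|X c A B]; rewrite /act /rendo_app ?linearP //.
by rewrite (env_lift_linear der_rendo_lie_map).
Qed.
HB.instance Definition _ :=
  bilinear_isBilinear.Build k Ug Ua Ug *:%R *:%R act act_bilinear.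

Lemma act1 X : act X 1 = X.
Proof. by rewrite /act (env_lift_one der_rendo_lie_map). Qed.

Lemma actM X A B : act X (A * B) = act (act X A) B.
Proof. by rewrite /act (env_lift_mul der_rendo_lie_map). Qed.

Lemma act_gen (x : g) (u : a) : act (env_gen x) (env_gen u) = env_gen (M x u).
Proof. by rewrite /act (env_lift_gen der_rendo_lie_map) /rendo_app /= der_gen. Qed.

Lemma act_derivation X Y (u : a) :
  act (X * Y) (env_gen u) = act X (env_gen u) * Y + X * act Y (env_gen u).
Proof. by rewrite /act (env_lift_gen der_rendo_lie_map) /rendo_app /= derM. Qed.

Lemma act_unique (b : Ug -> Ua -> Ug) :
  bilinear_for *:%R *:%R b ->
  (forall X, b X 1 = X) -> (forall X A B, b X (A * B) = b (b X A) B) ->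
  (forall (x : g) (u : a), b (env_gen x) (env_gen u) = env_gen (M x u)) ->
  (forall X Y (u : a), b (X * Y) (env_gen u) = b X (env_gen u) * Y + X * b Y (env_gen u)) ->
  forall X A, b X A = act X A.
Proof.
move=> [bl br] b1 bM bg bd X A; elim/env_ind: A X => [|u A IH|c A B hA hB] X.
- by rewrite b1 act1.
- rewrite bM actM IH; congr (act _ _).
  elim/env_ind: X => [|x X hX|c X Y hX hY].
  + have h0 (t : Ug) : t = t * 1 + 1 * t -> t = 0.
      by rewrite mulr1 mul1r => e; apply: (addIr t); rewrite add0r -e.
    rewrite (h0 (b 1 (env_gen u))); last by rewrite -bd mulr1.
    by rewrite (h0 (act 1 (env_gen u))) // -act_derivation mulr1.
  + by rewrite bd act_derivation hX bg act_gen.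
  + by rewrite bl linearPl hX hY.
- by rewrite br linearPr hA hB.
Qed.

End Action.

Section Products.
Variables (k : fieldType) (g a : lieAlgType k) (M : rLieModule g a).
Notation Ug := (env g).
Notation Ua := (env a).
Notation Hom := {linear env g -> env a}.

(* Coalgebra morphisms preserve the counit as well as the coproduct. *)
Definition coalg_morphism (A : Hom) : Prop :=
  (forall f, counit (A f) = counit f) /\
  (forall f, coprod (A f) = \sw_(u, v <- coprod f) A u \ox A v).

Definition conv_fun (A B : Hom) (f : Ug) : Ua :=
  \sw_(u, v <- coprod f) A u * B v.

Lemma conv_bilinear (A B : Hom) :
  bilinear_for *:%R *:%R (fun u v => A u * B v).
Proof.
by split=> [v c x y|u c x y] /=;
  rewrite linearP ?mulrDl ?mulrDr -?scalerAl -?scalerAr.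
Qed.

Lemma conv_linear (A B : Hom) : linear (conv_fun A B).
Proof.
by move=> c x y; rewrite /conv_fun linearP (tens_lift_linear (conv_bilinear A B)).
Qed.
HB.instance Definition _ A B :=
  GRing.isLinear.Build k Ug Ua *:%R (conv_fun A B) (conv_linear A B).
Definition conv (A B : Hom) : Hom := conv_fun A B.

Definition sharp_fun (A B : Hom) (f : Ug) : Ua :=
  \sw_(u, v <- coprod f) \sw_(b, c <- coprod (B v)) A (act M u (antipode b)) * c.

Lemma sharp_inner_bilinear (A : Hom) u :
  bilinear_for *:%R *:%R (fun b c => A (act M u (antipode b)) * c).
Proof.
split=> [c z x y|b z x y] /=; last by rewrite mulrDr -scalerAr.
by rewrite linearP linearPr linearP mulrDl -scalerAl.
Qed.

Lemma sharp_outer_bilinear (A B : Hom) :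
  bilinear_for *:%R *:%R (fun u v =>
    \sw_(b, c <- coprod (B v)) A (act M u (antipode b)) * c).
Proof.
split=> [v z x y|u z x y] /=; last first.
  by rewrite !linearP (tens_lift_linear (sharp_inner_bilinear A u)).
rewrite /tens_lift /formal_eval scaler_sumr -big_split /=.
by apply: eq_bigr => p _; rewrite linearPl linearP mulrDl -scalerAl.
Qed.

Lemma sharp_linear (A B : Hom) : linear (sharp_fun A B).
Proof.
by move=> c x y; rewrite /sharp_fun linearP (tens_lift_linear (sharp_outer_bilinear A B)).
Qed.
HB.instance Definition _ A B :=
  GRing.isLinear.Build k Ug Ua *:%R (sharp_fun A B) (sharp_linear A B).
Definition sharp (A B : Hom) : Hom := sharp_fun A B.

Definition unit_counit_fun (f : Ug) : Ua := (counit f)%:A.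
Lemma unit_counit_linear : linear unit_counit_fun.
Proof. by move=> c x y; rewrite /unit_counit_fun linearP scalerDl scalerA. Qed.
HB.instance Definition _ :=
  GRing.isLinear.Build k Ug Ua *:%R unit_counit_fun unit_counit_linear.
Definition unit_counit : Hom := unit_counit_fun.

End Products.

(* The subset G of T is a group for the law op, with unit e. *)
Definition is_group (T : Type) (G : T -> Prop) (op : T -> T -> T) (e : T) : Prop :=
  [/\ (forall x y, G x -> G y -> G (op x y)),
      G e,
      (forall x y z, G x -> G y -> G z -> op x (op y z) = op (op x y) z),
      (forall x, G x -> op e x = x /\ op x e = x) &
      (forall x, G x -> exists2 y, G y & op x y = e /\ op y x = e)].

(* Main.v *)
From HB Require Import structures.
Require Import Defs.
From mathcomp Require Import all_boot all_algebra.
From mathcomp Require Import boolp ssrAC.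
Import GRing.Theory.
Local Open Scope ring_scope.
Set Implicit Arguments.
Unset Strict Implicit.
Unset Printing Implicit Defensive.

(* Put [phi_B f = f_(1) <| S (B f_(2))]. When [B] is a morphism of coalgebras so
   is [phi_B], and [A # B = (A o phi_B) * B]; as [phi_(B # C) = phi_B o phi_C],
   associativity of [#] reduces to that of the convolution product.

   A left inverse of [A] is a [B] with [B o phi_A = S o A], so it suffices to
   invert [phi_A]. Up to the automorphism [f |-> f <| A 1] (whose inverse is
   [f |-> f <| S (A 1)], as [A 1] is grouplike) [phi_A] acts as the identity on
   the graded module of the degree filtration of U(g), because
   [f_(1) \ox f_(2)] is [f \ox 1] up to terms of lower degree on the left, and
   the action of U(a) preserves the filtration. Hence [phi_A] is bijective.

   Identities between iterated coproducts (coassociativity, cocommutativity) are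
   proved by induction on words, for all multilinear maps at once. *)

(** * Multilinear maps and sums over tensors *)

Notation bilin b := (bilinear_for *:%R *:%R b).

Section LinearMaps.
Variables (k : fieldType) (V W : lmodType k) (f : V -> W).
Hypothesis hf : linear f.

Lemma linear0P : f 0 = 0.
Proof. by apply: (addIr (f 0)); have := hf 1 0 0; rewrite !scale1r !addr0 add0r. Qed.

Lemma linearDP x y : f (x + y) = f x + f y.
Proof. by have := hf 1 x y; rewrite !scale1r. Qed.

Lemma linearNP x : f (- x) = - f x.
Proof. by have := hf (-1) x 0; rewrite linear0P !addr0 !scaleN1r. Qed.
End LinearMaps.

Section TensorSums.
Variables (k : fieldType) (U V W : lmodType k).
Implicit Types (b : U -> V -> W) (t : tens U V).

(** [tens_lift] is a finite sum over one chosen representative of [t], so this rule and the next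
    ones are facts about finite sums. *)
Lemma eq_sw b b' t : (forall u v, b u v = b' u v) -> tens_lift b t = tens_lift b' t.
Proof. by move=> e; apply: eq_bigr => p _; apply: e. Qed.

Lemma swP b b' c t :
  \sw_(u, v <- t) (c *: b u v + b' u v) =
  c *: (\sw_(u, v <- t) b u v) + \sw_(u, v <- t) b' u v.
Proof. by rewrite /tens_lift /formal_eval scaler_sumr -big_split. Qed.

Lemma swD b b' t :
  \sw_(u, v <- t) (b u v + b' u v) =
  \sw_(u, v <- t) b u v + \sw_(u, v <- t) b' u v.
Proof. by rewrite /tens_lift /formal_eval -big_split. Qed.

Lemma sw0 t : \sw_(u, v <- t) (0 : W) = 0.
Proof. by rewrite /tens_lift /formal_eval big1. Qed.

Lemma linear_sw (Z : lmodType k) (L : W -> Z) b t : linear L ->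
  L (tens_lift b t) = \sw_(u, v <- t) L (b u v).
Proof. by move=> hL; apply: (big_morph L (linearDP hL) (linear0P hL)). Qed.

Lemma tens_lift_pure_id t : tens_lift (@pure k U V) t = t.
Proof. by symmetry; apply: (tens_lift_unique (pure_bilinear U V) (phi := id)). Qed.

Lemma bilin_comp_fun (U' V' : lmodType k) b (P : U' -> U) (Q : V' -> V) :
  bilin b -> linear P -> linear Q -> bilin (fun u v => b (P u) (Q v)).
Proof.
move=> [bl br] hP hQ; split=> [v c x y|u c x y] /=; first by rewrite hP; exact: bl.
by rewrite hQ; exact: br.
Qed.

Lemma bilin_comp (U' V' : lmodType k) b (P : {linear U' -> U}) (Q : {linear V' -> V}) :
  bilin b -> bilin (fun u v => b (P u) (Q v)).
Proof. by move=> hb; apply: bilin_comp_fun => //; exact: linearP. Qed.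

Lemma bilin_flip b : bilin b -> bilin (fun v u => b u v).
Proof. by case=> bl br; split=> [u|v]; [exact: br | exact: bl]. Qed.

Lemma bilin_linear (Z : lmodType k) (L : W -> Z) b : linear L ->
  bilin b -> bilin (fun u v => L (b u v)).
Proof.
move=> hL [bl br]; split=> [v c x y|u c x y] /=; last by rewrite br hL.
have := bl v c x y; rewrite /= => ->; exact: hL.
Qed.

Lemma bilinD b b' : bilin b -> bilin b' -> bilin (fun u v => b u v + b' u v).
Proof.
move=> [bl br] [bl' br']; split=> [v c x y|u c x y] /=; last first.
  by rewrite br br' scalerDr addrACA.
by have /= -> := bl v c x y; have /= -> := bl' v c x y; rewrite scalerDr addrACA.
Qed.

End TensorSums.

Lemma linear_sw_param (k : fieldType) (U V T W : lmodType k) (B : T -> U -> V -> W)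
    (t : tens U V) :
  (forall u v, linear (fun x => B x u v)) -> linear (fun x => \sw_(u, v <- t) B x u v).
Proof. by move=> hB c x y; rewrite -swP; apply: eq_sw => u v; apply: hB. Qed.

Lemma bilin_sw (k : fieldType) (U V S T W : lmodType k) (B : S -> T -> U -> V -> W)
    (t : tens U V) :
  (forall u v, bilin (fun x y => B x y u v)) ->
  bilin (fun x y => \sw_(u, v <- t) B x y u v).
Proof.
by move=> hB; split=> [y|x]; apply: linear_sw_param => u v; have [hl hr] := hB u v;
  [exact: hl | exact: hr].
Qed.

(** Stands in for a linear map on a threefold tensor product: iterated coproducts are only ever seen
    through multilinear maps, as nested sums. *)
Definition trilin (k : fieldType) (U V W Z : lmodType k) (F : U -> V -> W -> Z) : Prop :=
  [/\ forall v w, linear (fun u => F u v w), forall u w, linear (fun v => F u v w)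
    & forall u v, linear (F u v)].

Definition quadrilin (k : fieldType) (U V W T Z : lmodType k)
    (F : U -> V -> W -> T -> Z) : Prop :=
  [/\ forall v w t, linear (fun u => F u v w t), forall u w t, linear (fun v => F u v w t),
      forall u v t, linear (fun w => F u v w t) & forall u v w, linear (F u v w)].

Lemma trilinD (k : fieldType) (V1 V2 V3 W : lmodType k) (F F' : V1 -> V2 -> V3 -> W) :
  trilin F -> trilin F' -> trilin (fun u v w => F u v w + F' u v w).
Proof.
move=> [h1 h2 h3] [h1' h2' h3']; split=> [v w c x y|u w c x y|u v c x y] /=.
- by rewrite h1 h1' scalerDr addrACA.
- by rewrite h2 h2' scalerDr addrACA.
- by rewrite h3 h3' scalerDr addrACA.
Qed.

Lemma quadrilinD (k : fieldType) (V1 V2 V3 V4 W : lmodType k) (F F' : V1 -> V2 -> V3 -> V4 -> W) :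
  quadrilin F -> quadrilin F' ->
  quadrilin (fun u v w t => F u v w t + F' u v w t).
Proof.
move=> [h1 h2 h3 h4] [h1' h2' h3' h4'].
split=> [v w t c x y|u w t c x y|u v t c x y|u v w c x y] /=.
- by rewrite h1 h1' scalerDr addrACA.
- by rewrite h2 h2' scalerDr addrACA.
- by rewrite h3 h3' scalerDr addrACA.
- by rewrite h4 h4' scalerDr addrACA.
Qed.

Lemma mul_bilin (k : fieldType) (A : algType k) : bilin (fun x y : A => x * y).
Proof.
split=> [v c x y|u c x y] /=; first by rewrite mulrDl -scalerAl.
by rewrite mulrDr -scalerAr.
Qed.

(** * Coproduct, counit and antipode of an envelope *)

Section Coalgebra.
Variables (k : fieldType) (g : lieAlgType k).
Notation U := (env g).

Lemma sw_coprod_linear (W : lmodType k) (b : U -> U -> W) :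
  bilin b -> linear (fun X => tens_lift b (coprod X)).
Proof. by move=> hb c X Y; rewrite linearP (tens_lift_linear hb). Qed.

Lemma sw_coprod1 (W : lmodType k) (b : U -> U -> W) :
  bilin b -> tens_lift b (coprod 1) = b 1 1.
Proof.
have -> : coprod 1 = (1 : U) \ox (1 : U) by exact: (rmorph1 (@coprod k g)).
by move=> hb; rewrite (tens_lift_pure hb).
Qed.

Lemma sw_coprodM (W : lmodType k) (b : U -> U -> W) (X Y : U) :
  bilin b -> tens_lift b (coprod (X * Y)) =
    \sw_(u, v <- coprod X) \sw_(p, q <- coprod Y) b (u * p) (v * q).
Proof.
move=> hb; rewrite rmorphM (linear_sw _ _ (tens_lift_linear hb)).
apply: eq_sw => u v; rewrite (linear_sw _ _ (tens_lift_linear hb)).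
by apply: eq_sw => p q; rewrite tens_lift_pure.
Qed.

Lemma sw_coprod_gen (W : lmodType k) (b : U -> U -> W) (x : g) :
  bilin b -> tens_lift b (coprod (env_gen x)) = b (env_gen x) 1 + b 1 (env_gen x).
Proof.
by move=> hb; rewrite coprod_gen (tens_lift_add hb) !(tens_lift_pure hb).
Qed.

Lemma bilin_mull (W : lmodType k) (b : U -> U -> W) (x y : U) :
  bilin b -> bilin (fun u v => b (x * u) (y * v)).
Proof.
move=> [bl br]; split=> [v c X Y|u c X Y] /=; rewrite mulrDr -scalerAr; [exact: bl|exact: br].
Qed.

Lemma bilin_mulr (W : lmodType k) (b : U -> U -> W) (x y : U) :
  bilin b -> bilin (fun u v => b (u * x) (v * y)).
Proof.
move=> [bl br]; split=> [v c X Y|u c X Y] /=; rewrite mulrDl -scalerAl; [exact: bl|exact: br].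
Qed.

(** The generator [x] is primitive, so multiplying by it puts one copy of [x] on either factor. This
    is the step of most inductions on words below. *)
Lemma sw_coprod_genl (W : lmodType k) (b : U -> U -> W) (x : g) (X : U) :
  bilin b -> tens_lift b (coprod (env_gen x * X)) =
    \sw_(u, v <- coprod X) (b (env_gen x * u) v + b u (env_gen x * v)).
Proof.
move=> hb; rewrite sw_coprodM // sw_coprod_gen; last first.
  by apply: bilin_sw => p q; apply: bilin_mulr.
by rewrite -swD; apply: eq_sw => u v; rewrite !mul1r.
Qed.

Lemma sw_coprod_genr (W : lmodType k) (b : U -> U -> W) (x : g) (X : U) :
  bilin b -> tens_lift b (coprod (X * env_gen x)) =
    \sw_(u, v <- coprod X) (b (u * env_gen x) v + b u (v * env_gen x)).
Proof.
move=> hb; rewrite sw_coprodM //; apply: eq_sw => u v.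
by rewrite sw_coprod_gen ?mulr1 //; apply: bilin_mull.
Qed.

Lemma linear_genl (x : g) : linear (fun X : U => env_gen x * X).
Proof. by move=> c X Y; rewrite mulrDr -scalerAr. Qed.

Lemma sw_coprodC (W : lmodType k) (b : U -> U -> W) (X : U) :
  bilin b -> \sw_(u, v <- coprod X) b u v = \sw_(u, v <- coprod X) b v u.
Proof.
(* The form [b] stays general, because the step applies the hypothesis for [X] to the new form
   [b (x u) v + b u (x v)]. *)
elim/env_ind: X b => [|x X IH|c X Y IHX IHY] b hb.
- by rewrite !sw_coprod1 //; apply: bilin_flip.
- have hb' := bilin_flip hb.
  rewrite !sw_coprod_genl // IH; first by apply: eq_sw => u v; rewrite addrC.
  move: (mul_bilin U) => [ml mr]; case: hb => hl hr.
  apply: bilinD; split => [v|u] c X1 X2 /=; rewrite ?(mulrDr, =^~scalerAr).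
  + exact: hl.
  + exact: hr.
  + exact: hl.
  + exact: hr.
- by have hb' := bilin_flip hb; rewrite !sw_coprod_linear // IHX // IHY.
Qed.

Lemma sw_coprodA (W : lmodType k) (F : U -> U -> U -> W) (X : U) : trilin F ->
  \sw_(u, v <- coprod X) \sw_(p, q <- coprod u) F p q v =
  \sw_(u, v <- coprod X) \sw_(p, q <- coprod v) F u p q.
Proof.
have bl (F' : U -> U -> U -> W) : trilin F' ->
    bilin (fun u v => \sw_(p, q <- coprod u) F' p q v) /\
    bilin (fun u v => \sw_(p, q <- coprod v) F' u p q).
  move=> [h1 h2 h3]; split; split=> [v|u].
  - by apply: (sw_coprod_linear (b := fun p q => F' p q v)); split=> *;
      [apply: h1|apply: h2].
  - by apply: linear_sw_param => p q; apply: h3.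
  - by apply: linear_sw_param => p q; apply: h1.
  - by apply: (sw_coprod_linear (b := F' u)); split=> *; [apply: h2|apply: h3].
elim/env_ind: X F => [|x X IH|c X Y IHX IHY] F hF; have [h1 h2 h3] := hF;
  have [b1 b2] := bl F hF.
- by rewrite !sw_coprod1.
- rewrite !sw_coprod_genl //.
  (* [F'] distributes [x] over the three slots of [F]: both sides for [x X] and [F] become the
     corresponding sides for [X] and [F']. *)
  pose F' p q v := F (env_gen x * p) q v + F p (env_gen x * q) v + F p q (env_gen x * v).
  have hF' : trilin F'.
    by apply: trilinD; first apply: trilinD; split=> [v w|u w|u v] c X1 X2 /=;
      rewrite ?(mulrDr, =^~scalerAr); [apply: h1|apply: h2|apply: h3
        |apply: h1|apply: h2|apply: h3|apply: h1|apply: h2|apply: h3].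
  transitivity (\sw_(u, v <- coprod X) \sw_(p, q <- coprod u) F' p q v).
    by apply: eq_sw => u v; rewrite sw_coprod_genl -?swD.
  rewrite IH //; apply: eq_sw => u v; rewrite [X in _ = _ + X]sw_coprod_genl -?swD.
    by apply: eq_sw => p q; rewrite /F' addrA.
  by split=> *; [apply: h2|apply: h3].
- by rewrite !sw_coprod_linear // IHX // IHY.
Qed.

Lemma sw4_bilin (W : lmodType k) (F : U -> U -> U -> U -> W) : quadrilin F ->
  bilin (fun u v => \sw_(p, q <- coprod u) \sw_(r, s <- coprod v) F p q r s).
Proof.
move=> [h1 h2 h3 h4]; split=> [v|u].
  apply: (sw_coprod_linear (b := fun p q => \sw_(r, s <- coprod v) F p q r s)).
  by apply: bilin_sw => r s; split=> *; [apply: h1|apply: h2].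
apply: linear_sw_param => p q.
by apply: (sw_coprod_linear (b := F p q)); split=> *; [apply: h3|apply: h4].
Qed.

Lemma sw4_genl (W : lmodType k) (F : U -> U -> U -> U -> W) (x : g) (X : U) :
  quadrilin F ->
  \sw_(u, v <- coprod (env_gen x * X))
    \sw_(p, q <- coprod u) \sw_(r, s <- coprod v) F p q r s =
  \sw_(u, v <- coprod X) \sw_(p, q <- coprod u) \sw_(r, s <- coprod v)
    (F (env_gen x * p) q r s + F p (env_gen x * q) r s
     + (F p q (env_gen x * r) s + F p q r (env_gen x * s))).
Proof.
move=> hF; have [h1 h2 h3 h4] := hF; rewrite sw_coprod_genl; last exact: sw4_bilin.
apply: eq_sw => u v; rewrite sw_coprod_genl -?swD; last first.
  by apply: bilin_sw => r s; split=> *; [apply: h1|apply: h2].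
apply: eq_sw => p q; rewrite sw_coprod_genl -?swD //.
Qed.

(* Cocommutativity makes the coproduct a morphism of coalgebras: this is the
   interchange of the two middle factors of the fourfold coproduct. *)
Lemma sw_coprodACA (W : lmodType k) (F : U -> U -> U -> U -> W) (X : U) :
  quadrilin F ->
  \sw_(u, v <- coprod X) \sw_(p, q <- coprod u) \sw_(r, s <- coprod v) F p q r s =
  \sw_(u, v <- coprod X) \sw_(p, q <- coprod u) \sw_(r, s <- coprod v) F p r q s.
Proof.
elim/env_ind: X F => [|x X IH|c X Y IHX IHY] F hF; have [h1 h2 h3 h4] := hF;
  have hF' : quadrilin (fun p q r s => F p r q s)
    by split=> *; [apply: h1|apply: h3|apply: h2|apply: h4].
- have b1 := sw4_bilin hF; have b2 := sw4_bilin hF'.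
  rewrite !(sw_coprod1 b1, sw_coprod1 b2) !sw_coprod1 //.
    by apply: bilin_sw => r s; split=> *; [apply: h1|apply: h3].
  by apply: bilin_sw => r s; split=> *; [apply: h1|apply: h2].
- rewrite (sw4_genl _ _ hF) (sw4_genl _ _ hF') IH.
    (* Interchanging the middle arguments of [F] exchanges the two middle ones of the four summands,
       in which [x] sits in the second or the third slot. *)
    by do 3![apply: eq_sw => ? ?]; rewrite [LHS]addrACA.
  apply: quadrilinD; apply: quadrilinD; split=> [q r s|p r s|p q s|p q r] c X1 X2 /=;
    rewrite ?(mulrDr, =^~scalerAr) ?(h1, h2, h3, h4) //.
- by rewrite !(sw_coprod_linear (sw4_bilin hF), sw_coprod_linear (sw4_bilin hF')) IHX // IHY.
Qed.

Lemma counit_linear : linear (counit : U -> k^o).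
Proof. exact: (linearP (@counit k g)). Qed.

Lemma coprod_linear : linear (coprod : U -> tens U U).
Proof. exact: (linearP (@coprod k g)). Qed.

Lemma counitM (X Y : U) : counit (X * Y) = counit X * counit Y.
Proof. exact: (rmorphM (@counit k g)). Qed.

Lemma counit_genM (x : g) (X : U) : counit (env_gen x * X) = 0.
Proof. by rewrite counitM counit_gen mul0r. Qed.

(** The counit kills the terms where [x] lands on the left factor; the others are the case of the
    linear map [v |-> L (x v)], whence the arbitrary [L]. *)
Lemma sw_counitl (W : lmodType k) (L : U -> W) (X : U) : linear L ->
  \sw_(u, v <- coprod X) (counit u *: L v) = L X.
Proof.
elim/env_ind: X L => [|x X IH|c X Y IHX IHY] L hL.
all: have hb L' : linear L' -> bilin (fun u v : U => counit u *: L' v : W)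
  by move=> hL'; split=> [v|u] c1 X1 X2; rewrite /= ?linearP ?hL' ?scalerDl
    ?scalerDr ?scalerA // mulrC.
- by rewrite (sw_coprod1 (hb _ hL)) rmorph1 scale1r.
- rewrite (sw_coprod_genl _ _ (hb _ hL)).
  rewrite -[RHS](IH (fun v => L (env_gen x * v))).
    by apply: eq_sw => u v; rewrite counit_genM scale0r add0r.
  by move=> c1 X1 X2; rewrite linear_genl hL.
- by rewrite (sw_coprod_linear (hb _ hL)) IHX // IHY // hL.
Qed.

Lemma sw_counitr (W : lmodType k) (L : U -> W) (X : U) : linear L ->
  \sw_(u, v <- coprod X) (counit v *: L u) = L X.
Proof.
move=> hL; rewrite -[RHS]sw_counitl // sw_coprodC //.
by split=> [v|u] c1 X1 X2; rewrite /= ?linearP ?hL ?scalerDl ?scalerDr ?scalerA // mulrC.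
Qed.

Lemma sw_antipodel (X : U) : \sw_(u, v <- coprod X) (antipode u * v) = (counit X)%:A.
Proof.
have hb : bilin (fun u v : U => antipode u * v).
  exact: (bilin_comp antipode idfun (mul_bilin U)).
elim/env_ind: X => [|x X IH|c X Y IHX IHY].
- by rewrite (sw_coprod1 hb) antipode1 mulr1 rmorph1 scale1r.
- rewrite (sw_coprod_genl _ _ hb) counit_genM scale0r -[RHS](sw0 U (coprod X)).
  (* The two terms cancel for each pair [u], [v], since [S (x u) = - S u x]. *)
  by apply: eq_sw => u v; rewrite antipodeM antipode_gen mulrN mulNr mulrA addNr.
- by rewrite (sw_coprod_linear hb) IHX IHY linearP scalerDl scalerA.
Qed.

Lemma sw_antipoder (X : U) : \sw_(u, v <- coprod X) (u * antipode v) = (counit X)%:A.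
Proof.
have hb : bilin (fun u v : U => u * antipode v).
  exact: (bilin_comp idfun antipode (mul_bilin U)).
elim/env_ind: X => [|x X IH|c X Y IHX IHY].
- by rewrite (sw_coprod1 hb) antipode1 mulr1 rmorph1 scale1r.
- rewrite (sw_coprod_genl _ _ hb) counit_genM scale0r swD.
  have hl : linear (fun Z : U => env_gen x * Z) by exact: linear_genl.
  have hr : linear (fun Z : U => - (Z * env_gen x)).
    by move=> c X1 X2; rewrite mulrDl -scalerAl opprD scalerN.
  (* Here [x] ends up at opposite ends of [u S v], so nothing cancels termwise. The induction
     hypothesis turns the sums into a commutator of [x] with a scalar, which vanishes. *)
  transitivity (env_gen x * (counit X)%:A - (counit X)%:A * env_gen x : U).
    rewrite -IH (linear_sw _ _ hl) (linear_sw _ _ hr).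
    congr (_ + _); first by apply: eq_sw => u v; rewrite mulrA.
    by apply: eq_sw => u v; rewrite antipodeM antipode_gen !mulrN mulrA.
  by rewrite -scalerAl -scalerAr mulr1 mul1r subrr.
- by rewrite (sw_coprod_linear hb) IHX IHY linearP scalerDl scalerA.
Qed.
End Coalgebra.

(** * Coalgebra morphisms and the twist *)

Section CoalgebraMorphisms.
Variables (k : fieldType).
Implicit Types g h : lieAlgType k.

Lemma sw_coalg g h (A : {linear env g -> env h}) (W : lmodType k)
    (b : env h -> env h -> W) (X : env g) :
  coalg_morphism A -> bilin b ->
  tens_lift b (coprod (A X)) = \sw_(u, v <- coprod X) b (A u) (A v).
Proof.
move=> [_ hA] hb; rewrite hA (linear_sw _ _ (tens_lift_linear hb)).
by apply: eq_sw => u v; rewrite tens_lift_pure.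
Qed.

Lemma coalg_comp g h l (A : {linear env h -> env l}) (B : {linear env g -> env h}) :
  coalg_morphism A -> coalg_morphism B -> coalg_morphism (A \o B).
Proof.
move=> hA hB; split=> X /=; first by rewrite hA.1 hB.1.
by rewrite hA.2 (sw_coalg _ hB) //; apply: bilin_comp; exact: pure_bilinear.
Qed.

Lemma coalg_id g : coalg_morphism (idfun : {linear env g -> env g}).
Proof. by split=> X //=; rewrite tens_lift_pure_id. Qed.

(** An antipode reverses the factors of a coproduct in general; cocommutativity makes the order
    immaterial. As [S] turns left multiplication by [x] into right multiplication by [- x], the
    induction needs [sw_coprod_genr] too. *)
Lemma sw_antipode g (W : lmodType k) (b : env g -> env g -> W) (X : env g) : bilin b ->
  tens_lift b (coprod (antipode X)) = \sw_(u, v <- coprod X) b (antipode u) (antipode v).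
Proof.
elim/env_ind: X b => [|x X IH|c X Y IHX IHY] b hb;
  have hb' : bilin (fun u v => b (antipode u) (antipode v))
    by exact: (bilin_comp antipode antipode hb).
- by rewrite antipode1 (sw_coprod1 hb) (sw_coprod1 hb') antipode1.
- have [hl hr] := hb.
  rewrite antipodeM antipode_gen mulrN (linearNP (sw_coprod_linear hb)).
  rewrite (sw_coprod_genr _ _ hb) (sw_coprod_genl _ _ hb') IH; last first.
    apply: bilinD; split=> [v|u] c X1 X2 /=; rewrite ?mulrDl -?scalerAl;
      [exact: hl|exact: hr|exact: hl|exact: hr].
  rewrite -scaleN1r -[LHS]addr0 -(sw0 W (coprod X)) -swP; apply: eq_sw => u v.
  rewrite addr0 scaleN1r !antipodeM !antipode_gen !mulrN.
  by rewrite (linearNP (hl _)) (linearNP (hr _)) opprD.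
- by rewrite linearP (sw_coprod_linear hb) IHX // IHY // (sw_coprod_linear hb').
Qed.

Lemma counit_antipode g (X : env g) : counit (antipode X) = counit X.
Proof.
elim/env_ind: X => [|x X IH|c X Y IHX IHY].
- by rewrite antipode1.
- rewrite antipodeM antipode_gen counitM counit_genM.
  by rewrite (linearNP (counit_linear (g := g))) counit_gen oppr0 mulr0.
- by rewrite linearP /= !(linearP (@counit k g)) /= IHX IHY.
Qed.

Lemma coalg_antipode g : coalg_morphism (antipode : {linear env g -> env g}).
Proof.
split=> X /=; first exact: counit_antipode.
by rewrite -[LHS]tens_lift_pure_id sw_antipode //; apply: pure_bilinear.
Qed.

(** Common source of [coalg_twist], where [b] is the action, and [coalg_conv], where [b] is the
    multiplication. [R] is the coproduct followed by [P \ox Q] and by [b], all coalgebra maps; for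
    the coproduct this is [sw_coprodACA]. *)
Lemma coalg_convolution g h1 h2 h3 (P : {linear env g -> env h1})
    (Q : {linear env g -> env h2}) (b : env h1 -> env h2 -> env h3)
    (R : {linear env g -> env h3}) :
  bilin b -> coalg_morphism P -> coalg_morphism Q ->
  (forall x y, counit (b x y) = counit x * counit y) ->
  (forall x y, coprod (b x y) =
     \sw_(p, q <- coprod x) \sw_(r, s <- coprod y) b p r \ox b q s) ->
  (forall X, R X = \sw_(u, v <- coprod X) b (P u) (Q v)) ->
  coalg_morphism R.
Proof.
move=> hb hP hQ hbe hbD hR; have [bl br] := hb; have hp := pure_bilinear (env h3) (env h3).
split=> X.
  rewrite hR (linear_sw _ _ (counit_linear (g := h3))) /=.
  under eq_sw => u v do rewrite hbe hP.1 hQ.1.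
  exact: (sw_counitl (W := k^o) X (counit_linear (g := g))).
have [bPl bQr] := bilin_comp P Q hb.
pose F p q r s := b (P p) (Q r) \ox b (P q) (Q s).
have hF : quadrilin F.
  split=> [q r s|p r s|p q s|p q r].
  - exact: (bilin_comp_fun (b := @pure _ _ _) hp (bPl r) (bPl s)).1.
  - exact: (bilin_comp_fun (b := @pure _ _ _) hp (bPl r) (bPl s)).2.
  - exact: (bilin_comp_fun (b := @pure _ _ _) hp (bQr p) (bQr q)).1.
  - exact: (bilin_comp_fun (b := @pure _ _ _) hp (bQr p) (bQr q)).2.
rewrite hR (linear_sw _ _ (coprod_linear (g := h3))) /=.
transitivity (\sw_(u, v <- coprod X) \sw_(p, q <- coprod u) \sw_(r, s <- coprod v) F p q r s).
  apply: eq_sw => u v; rewrite hbD (sw_coalg _ hP); last first.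
    by apply: bilin_sw => r s; exact: (bilin_comp_fun hp (bl r) (bl s)).
  apply: eq_sw => p q; rewrite (sw_coalg _ hQ) //.
  exact: (bilin_comp_fun hp (br (P p)) (br (P q))).
rewrite (sw_coprodACA _ hF); apply: eq_sw => u v.
rewrite !hR (linear_sw _ _ (hp.1 _)) /=; apply: eq_sw => p q.
by rewrite (linear_sw _ _ (hp.2 _)).
Qed.

Lemma coprodM g (X Y : env g) : coprod (X * Y) =
  \sw_(p, q <- coprod X) \sw_(r, s <- coprod Y) (p * r) \ox (q * s).
Proof.
rewrite -(tens_lift_pure_id (coprod (X * Y))) sw_coprodM //; exact: pure_bilinear.
Qed.

(** * The action as a coalgebra map, the twist and its composition law *)

Section Twist.
Variables (g a : lieAlgType k) (M : rLieModule g a).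
Notation Hom := {linear env g -> env a}.
Notation ract := (@act k g a M).

(** [der M u] is also a coderivation: it sends generators to generators, which are primitive, and
    the Leibniz rule extends this to words. *)
Lemma sw_der (W : lmodType k) (b : env g -> env g -> W) (u : a) (X : env g) : bilin b ->
  tens_lift b (coprod (der M u X)) =
  \sw_(p, q <- coprod X) (b (der M u p) q + b p (der M u q)).
Proof.
have hd := linearP (der M u).
elim/env_ind: X b => [|x X IH|c X Y IHX IHY] b hb; have [hl hr] := hb;
  have hd' : bilin (fun p q => b (der M u p) q + b p (der M u q))
    by apply: bilinD; [exact: (bilin_comp (der M u) idfun hb)
                       |exact: (bilin_comp idfun (der M u) hb)].
- rewrite (sw_coprod1 hd') /= der1 (linear0P (sw_coprod_linear hb)).
  by rewrite (linear0P (hl _)) (linear0P (hr _)) addr0.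
- have hx1 : bilin (fun p q => b (env_gen x * p) q).
    exact: (bilin_comp_fun hb (@linear_genl _ _ x) (linearP idfun)).
  have hx2 : bilin (fun p q => b p (env_gen x * q)).
    exact: (bilin_comp_fun hb (linearP idfun) (@linear_genl _ _ x)).
  rewrite derM der_gen linearD (tens_lift_add hb) /=.
  rewrite !(sw_coprod_genl _ _ hb) (sw_coprod_genl _ _ hd').
  rewrite (IH (fun p q => b (env_gen x * p) q + b p (env_gen x * q))); last exact: bilinD.
  rewrite -swD; apply: eq_sw => p q; rewrite !derM !der_gen.
  have /= -> := linearDP (hl q) (env_gen (M x u) * p) (env_gen x * der M u p).
  rewrite (linearDP (hr p) (env_gen (M x u) * q) (env_gen x * der M u q)).
  (* Summands 1 and 3 form the derivative of [x p] on the left factor, 2 and 6 that of [x q] on the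
     right factor; 4 and 5 are the mixed terms. *)
  by rewrite [LHS](AC (2*(2*2)) ((1*3*5)*(4*(2*6)))).
- by rewrite hd !sw_coprod_linear // IHX // IHY.
Qed.

Lemma act_genM (X : env g) (u : a) (A : env a) : ract X (env_gen u * A) = ract (der M u X) A.
Proof.
by rewrite actM /act (env_lift_gen (der_rendo_lie_map M)).
Qed.

Lemma act_bil : bilin ract. Proof. exact: act_bilinear. Qed.

(** The first letter of a word in U(a) acts by a coderivation, and the rest of the word then acts on
    the result; so the induction runs on [A] with [X] general. *)
Lemma sw_act (W : lmodType k) (b : env g -> env g -> W) (X : env g) (A : env a) : bilin b ->
  tens_lift b (coprod (ract X A)) =
  \sw_(p, q <- coprod X) \sw_(r, s <- coprod A) b (ract p r) (ract q s).
Proof.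
move=> hb; have [al ar] := act_bil.
have h2 p q : bilin (fun r s => b (ract p r) (ract q s)).
  exact: (bilin_comp_fun hb (ar p) (ar q)).
have h1 r s : bilin (fun p q => b (ract p r) (ract q s)).
  exact: (bilin_comp_fun hb (al r) (al s)).
elim/env_ind: A X => [|u A IH|c A B IHA IHB] X.
- by rewrite act1; apply: eq_sw => p q; rewrite (sw_coprod1 (h2 p q)) !act1.
- rewrite act_genM IH sw_der; last by apply: bilin_sw.
  apply: eq_sw => p q; rewrite (sw_coprod_genl _ _ (h2 p q)) swD.
  by congr (_ + _); apply: eq_sw => r s; rewrite act_genM.
- rewrite ar (sw_coprod_linear hb) IHA IHB -swP; apply: eq_sw => p q.
  by rewrite (sw_coprod_linear (h2 p q)).
Qed.

Lemma coprod_act (X : env g) (A : env a) : coprod (ract X A) =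
  \sw_(p, q <- coprod X) \sw_(r, s <- coprod A) ract p r \ox ract q s.
Proof. rewrite -[LHS]tens_lift_pure_id sw_act //; exact: pure_bilinear. Qed.

Lemma counit_der (u : a) (X : env g) : counit (der M u X) = 0.
Proof.
elim/env_ind: X => [|x X IH|c X Y IHX IHY].
- by rewrite der1 (linear0P (counit_linear (g := g))).
- by rewrite derM der_gen linearD /= !counit_genM addr0.
- by rewrite !linearP /= IHX IHY mulr0 addr0.
Qed.

Lemma counit_act (X : env g) (A : env a) : counit (ract X A) = counit X * counit A.
Proof.
elim/env_ind: A X => [|u A IH|c A B IHA IHB] X.
- by rewrite act1 rmorph1 mulr1.
- by rewrite act_genM IH counit_der counit_genM mulr0 mul0r.
- by rewrite linearPr !linearP /= IHA IHB mulrDr mulrCA.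
Qed.

(* [phi_B] in the introduction. *)
Definition twist_fun (B : Hom) (X : env g) : env g :=
  \sw_(u, v <- coprod X) ract u (antipode (B v)).

Lemma twist_bilin (B : Hom) : bilin (fun u v => ract u (antipode (B v))).
Proof. exact: (bilin_comp idfun (antipode \o B) act_bil). Qed.

Lemma twist_linear (B : Hom) : linear (twist_fun B).
Proof. exact: (sw_coprod_linear (twist_bilin B)). Qed.
HB.instance Definition _ (B : Hom) :=
  GRing.isLinear.Build k (env g) (env g) *:%R (twist_fun B) (twist_linear B).
Definition twist (B : Hom) : {linear env g -> env g} := twist_fun B.

Lemma coalg_twist (B : Hom) : coalg_morphism B -> coalg_morphism (twist B).
Proof.
move=> hB; apply: (coalg_convolution act_bil (coalg_id g)
  (coalg_comp (coalg_antipode a) hB) counit_act coprod_act) => X //.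
Qed.

Lemma coalg_conv (A B : Hom) :
  coalg_morphism A -> coalg_morphism B -> coalg_morphism (conv A B).
Proof.
move=> hA hB; apply: (coalg_convolution (mul_bilin (env a)) hA hB (@counitM k a) (@coprodM a)) => X //.
Qed.

Lemma coalg_unit_counit : coalg_morphism (unit_counit g a).
Proof.
split=> X /=; rewrite /unit_counit_fun.
  by rewrite linearZ /= rmorph1 mulr1.
have [pl pr] := pure_bilinear (env a) (env a).
rewrite linearZ /= (rmorph1 (@coprod k a)) -(scalable_linear (pr 1)).
have hL : linear (fun Y : env g => (1 : env a) \ox ((counit Y)%:A : env a)).
  by move=> c Y Z; rewrite linearP scalerDl -scalerA pr.
rewrite -[LHS](sw_counitl X hL); apply: eq_sw => u v.
by rewrite (scalable_linear (pl _)).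
Qed.

(** The product [#] splits the value [B v]. For a coalgebra morphism [B] this amounts to splitting
    [v], and coassociativity gives the first two of the three pieces to the twist and the last to
    [B]. *)
Lemma sharpE (A B : Hom) : coalg_morphism B -> sharp M A B = conv (A \o twist B) B.
Proof.
move=> hB; apply: linear_ext => X /=; rewrite /sharp_fun /conv_fun /=.
pose F u v w := A (ract u (antipode (B v))) * B w.
have [tl tr] := twist_bilin B.
have hF : trilin F.
  split=> [v w|u w|u v] c X1 X2; rewrite /F.
  - by have /= -> := tl v c X1 X2; rewrite linearP mulrDl -scalerAl.
  - by rewrite tr linearP mulrDl -scalerAl.
  - by rewrite linearP mulrDr -scalerAr.
transitivity (\sw_(u, v <- coprod X) \sw_(p, q <- coprod v) F u p q).
  apply: eq_sw => u v; rewrite (sw_coalg _ hB) //; exact: sharp_inner_bilinear.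
rewrite -(sw_coprodA _ hF); apply: eq_sw => u v.
have hL : linear (fun Y => A Y * B v).
  by move=> c Y Z; rewrite linearP mulrDl -scalerAl.
by rewrite /twist_fun (linear_sw _ _ hL).
Qed.

Lemma conv_precomp (A B : Hom) (phi : {linear env g -> env g}) :
  coalg_morphism phi -> conv (A \o phi) (B \o phi) = conv A B \o phi.
Proof.
move=> hphi; apply: linear_ext => X /=; rewrite /conv_fun (sw_coalg _ hphi) //.
exact: conv_bilinear.
Qed.

Lemma convA (A B C : Hom) : conv A (conv B C) = conv (conv A B) C.
Proof.
apply: linear_ext => X /=; rewrite /conv_fun /=.
pose F u v w := A u * B v * C w.
have hF : trilin F.
  by split=> [v w|u w|u v] c Y Z; rewrite /F linearP;
    rewrite ?mulrDr ?mulrDl -?scalerAr -?scalerAl ?mulrDl -?scalerAl.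
transitivity (\sw_(u, v <- coprod X) \sw_(p, q <- coprod v) F u p q).
  apply: eq_sw => u v; rewrite /conv_fun (linear_sw _ _ ((mul_bilin (env a)).2 _)).
  by apply: eq_sw => p q; rewrite mulrA.
rewrite -(sw_coprodA _ hF); apply: eq_sw => u v.
by rewrite /conv_fun (linear_sw _ _ ((mul_bilin (env a)).1 _)).
Qed.

(** By [sharpE] the left side is the twist of [B # C]. The antipode reverses the product of values
    of [B] and [C], so that in the right action [C] acts before [B], as in the composite. *)
Lemma twist_conv (B C : Hom) : coalg_morphism C ->
  twist (conv (B \o twist C) C) = twist B \o twist C.
Proof.
move=> hC; apply: linear_ext => X /=; symmetry.
rewrite /twist_fun (sw_coalg (A := twist C) _ (coalg_twist hC)); last exact: twist_bilin.
have [al ar] := act_bil; have [tl tr] := twist_bilin C.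
pose F u v w := ract (ract u (antipode (C v))) (antipode (B (twist C w))).
have hF : trilin F.
  split=> [v w|u w|u v] c Y Z; rewrite /F.
  - by have /= -> := tl v c Y Z; exact: al.
  - by rewrite tr; exact: al.
  - by rewrite !linearP ar.
transitivity (\sw_(u, v <- coprod X) \sw_(p, q <- coprod u) F p q v).
  apply: eq_sw => u v; rewrite /= /twist_fun.
  by rewrite (linear_sw (L := fun Y => ract Y _) _ _ (al _)).
rewrite (sw_coprodA _ hF); apply: eq_sw => u v /=.
(* Cocommutativity compensates for this reversal: [F] feeds [C] from its second argument and [B]
   from its third, the convolution the other way round. *)
rewrite sw_coprodC; last by case: hF => _ h2 h3; split=> *; [apply: h2|apply: h3].
have hL : linear (fun Y => ract u (antipode Y)) by move=> c Y Z; rewrite linearP ar.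
rewrite /conv_fun (linear_sw _ _ hL); apply: eq_sw => p q.
by rewrite antipodeM actM.
Qed.

End Twist.
End CoalgebraMorphisms.

(** * Invertibility of the twist *)

Section Filtration.
Variables (k : fieldType) (g : lieAlgType k).
Notation U := (env g).

(* The degree filtration shifted by one: [filt n.+1] is the span of the words
   of length at most [n], and [filt 0] is zero. *)
Inductive filt : nat -> U -> Prop :=
| filt_lin n c X Y : filt n X -> filt n Y -> filt n (c *: X + Y)
| filt_zero n : filt n 0
| filt_one n : filt n.+1 1
| filt_gen n x X : filt n.+1 X -> filt n.+2 (env_gen x * X).

Lemma filt0 X : filt 0 X -> X = 0.
Proof.
suff h n Y : filt n Y -> n = 0%N -> Y = 0 by move/h; apply.
elim=> {n Y} // n c Y Z _ IHY _ IHZ e.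
by rewrite IHY // IHZ // scaler0 addr0.
Qed.

Lemma filtD n X Y : filt n X -> filt n Y -> filt n (X + Y).
Proof. by move=> hX hY; rewrite -[X]scale1r; apply: filt_lin. Qed.

Lemma filtN n X : filt n X -> filt n (- X).
Proof. by move=> hX; rewrite -scaleN1r -[_ *: _]addr0; apply: filt_lin => //; apply: filt_zero. Qed.

Lemma filtS n X : filt n X -> filt n.+1 X.
Proof.
by elim=> {n X} [n c X Y _ hX _ hY|n|n|n x X _ hX]; [exact: filt_lin|exact: filt_zero
  |exact: filt_one|exact: filt_gen].
Qed.

Lemma filt_le m n X : (m <= n)%N -> filt m X -> filt n X.
Proof. by move/subnK <-; elim: (n - m)%N => // d IH /IH; apply: filtS. Qed.

Lemma filt_genM n x X : filt n X -> filt n.+1 (env_gen x * X).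
Proof.
case: n => [/filt0 ->|n]; last exact: filt_gen.
by rewrite mulr0; apply: filt_zero.
Qed.

Lemma filt_exhaustive X : exists n, filt n X.
Proof.
elim/env_ind: X => [|x X [n hX]|c X Y [m hX] [n hY]].
- by exists 1%N; apply: filt_one.
- by exists n.+1; apply: filt_genM.
- exists (maxn m n); apply: filt_lin; [exact: filt_le (leq_maxl _ _) hX
    |exact: filt_le (leq_maxr _ _) hY].
Qed.

(** Each letter of U(a) acts by a derivation that replaces one letter of a word by another element
    of [g], so words never get longer. *)
Lemma filt_act (a : lieAlgType k) (M : rLieModule g a) n X (A : env a) :
  filt n X -> filt n (act M X A).
Proof.
have hder u m Y : filt m Y -> filt m (der M u Y).
  elim=> {m Y} [m c Y Z _ hY _ hZ|m|m|m x Y hY IH].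
  - by rewrite linearP; apply: filt_lin.
  - by rewrite linear0; apply: filt_zero.
  - by rewrite der1; apply: filt_zero.
  - by rewrite derM der_gen; apply: filtD; apply: filt_genM.
elim/env_ind: A X => [|u A IH|c A B IHA IHB] X hX.
- by rewrite act1.
- by rewrite act_genM; apply: IH; apply: hder.
- by rewrite linearPr; apply: filt_lin; [apply: IHA|apply: IHB].
Qed.

(* The coproduct of [X] is [X \ox 1] modulo terms whose left factor has lower
   degree. *)
Lemma filt_coprod n m X (b : U -> U -> U) : bilin b -> filt n X ->
  (forall u v, filt n.-1 u -> filt m (b u v)) ->
  filt m (tens_lift b (coprod X) - b X 1).
Proof.
move=> hb hX; elim: hX b hb => {n X} [n c X Y _ hX _ hY|n|n|n x X hX IH] b hb h;
  have [hl hr] := hb.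
- rewrite (sw_coprod_linear hb); have /= -> := hl 1 c X Y.
  have -> (p q r s : U) : c *: p + q - (c *: r + s) = c *: (p - r) + (q - s).
    by rewrite scalerBr opprD addrACA.
  by apply: filt_lin; [apply: hX|apply: hY].
- rewrite (linear0P (sw_coprod_linear hb)) (linear0P (hl 1)) subr0; exact: filt_zero.
- by rewrite (sw_coprod1 hb) subrr; apply: filt_zero.
have hx1 : bilin (fun p q => b (env_gen x * p) q).
  exact: (bilin_comp_fun hb (@linear_genl _ _ x) (linearP idfun)).
have hx2 : bilin (fun p q => b p (env_gen x * q)).
  exact: (bilin_comp_fun hb (linearP idfun) (@linear_genl _ _ x)).
rewrite (sw_coprod_genl _ _ hb) swD addrAC.
apply: filtD; first by apply: (IH _ hx1) => u v hu; apply: h; apply: filt_genM.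
(* [X] has lower degree than [x X], so the leading term [b X x] of the second sum already falls
   under [h]. *)
rewrite -[X in filt m X](subrK (b X (env_gen x * 1))).
apply: filtD; last exact: h.
by apply: (IH _ hx2) => u v hu; apply: h; apply: filtS.
Qed.

(** [f - id] is locally nilpotent, as every element lies in some [filt n] and [filt 0] is zero. An
    element of the kernel thus descends to [filt 0], and a preimage of [Y] is [Y] minus a preimage
    of [f Y - Y]. *)
Lemma unipotent_bijective (f : {linear U -> U}) :
  (forall n X, filt n X -> filt n.-1 (f X - X)) ->
  injective f /\ forall Y, exists X, f X = Y.
Proof.
move=> hf; split=> [X Y e|Y].
  apply/eqP; rewrite -subr_eq0; apply/eqP.
  have: f (X - Y) = 0 by rewrite linearB e subrr.
  have [n] := filt_exhaustive (X - Y).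
  elim: n (X - Y) => [|n IH] Z hZ hfZ; first exact: filt0.
  by apply: IH => //; have := filtN (hf _ _ hZ); rewrite hfZ sub0r opprK.
have [n] := filt_exhaustive Y.
elim: n Y => [|n IH] Y hY; first by exists 0; rewrite linear0 (filt0 hY).
have [Z hZ] := IH _ (hf _ _ hY).
by exists (Y - Z); rewrite linearB hZ opprB addrC subrK.
Qed.
End Filtration.

(** * Inverses of the twist and for the convolution product *)

Section Inverse.
Variables (k : fieldType) (g a : lieAlgType k) (M : rLieModule g a).
Notation Hom := {linear env g -> env a}.

(** [A 1] is grouplike because [1] is, and the antipode axiom inverts grouplike elements. *)
Lemma coalg_antipode1 (A : Hom) : coalg_morphism A ->
  antipode (A 1) * A 1 = 1 /\ A 1 * antipode (A 1) = 1.
Proof.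
move=> hA; have h1 : (counit (A 1))%:A = 1 :> env a.
  by rewrite hA.1 (rmorph1 (@counit k g)) scale1r.
have [ml mr] := mul_bilin (env a).
have hb1 : bilin (fun u v : env a => antipode u * v).
  exact: (bilin_comp antipode idfun (mul_bilin (env a))).
have hb2 : bilin (fun u v : env a => u * antipode v).
  exact: (bilin_comp idfun antipode (mul_bilin (env a))).
have := sw_antipodel (A 1); have := sw_antipoder (A 1).
rewrite (sw_coalg _ hA hb1) (sw_coalg _ hA hb2) h1.
by rewrite (sw_coprod1 (bilin_comp A A hb1)) (sw_coprod1 (bilin_comp A A hb2)).
Qed.

Lemma twist_bijective (A : Hom) : coalg_morphism A -> exists psi : {linear env g -> env g},
  cancel (twist M A) psi /\ cancel psi (twist M A).
Proof.
move=> hA; have [SA AS] := coalg_antipode1 hA; have [al ar] := act_bil M.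
(* The leading term of [twist M A X] is [X] acted on by [S (A 1)]; acting by [A 1] afterwards
   restores [X], which makes [f] unipotent. *)
pose f_fun X := act M (twist M A X) (A 1).
have hf : linear f_fun by move=> c X Y; rewrite /f_fun linearP; apply: al.
pose fL := GRing.isLinear.Build k (env g) (env g) *:%R f_fun hf.
pose f : {linear env g -> env g} := HB.pack f_fun fL.
have fK X : act M (f X) (antipode (A 1)) = twist M A X.
  by rewrite /= /f_fun -actM AS act1.
have [finj fsurj] : injective f /\ forall Y, exists X, f X = Y.
  apply: unipotent_bijective => n X hX.
  (* Summed over the coproduct of [X], [b] gives [f X], while [b X 1] is [X] since [S (A 1)] is
     inverse to [A 1]; so [filt_coprod] bounds [f X - X]. *)
  pose b u v := act M (act M u (antipode (A v))) (A 1).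
  have hb : bilin b by exact: (bilin_linear (al (A 1)) (twist_bilin M A)).
  have -> : f X = tens_lift b (coprod X).
    by rewrite /= /f_fun /= /twist_fun (linear_sw (L := fun Y => act M Y (A 1)) _ _ (al _)).
  have {2}-> : X = b X 1 by rewrite /b -actM SA act1.
  by apply: filt_coprod hb hX _ => u v hu; do 2!apply: filt_act.
have tinj : injective (twist M A).
  by move=> X Y e; apply: finj; rewrite /= /f_fun e.
have tsurj Y : exists X, twist M A X = Y.
  have [X hX] := fsurj (act M Y (A 1)); exists X.
  by rewrite -fK hX -actM AS act1.
(* Preimages are chosen pointwise; linearity of [psi] comes afterwards, from its being a two-sided
   inverse of a linear map. *)
have [psi psiK] := choice tsurj.
have Kpsi : cancel (twist M A) psi by move=> X; apply: tinj; rewrite psiK.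
have hpsi : linear psi by exact: can2_linear Kpsi psiK.
pose psiL := GRing.isLinear.Build k (env g) (env g) *:%R psi hpsi.
by exists (HB.pack psi psiL : {linear env g -> env g}).
Qed.

Lemma coalg_inv (phi psi : {linear env g -> env g}) :
  coalg_morphism phi -> cancel phi psi -> cancel psi phi -> coalg_morphism psi.
Proof.
move=> hphi phiK psiK; split=> Y; first by rewrite -{2}[Y]psiK hphi.1.
rewrite -{2}[Y]psiK (sw_coalg _ hphi); last first.
  by apply: bilin_comp; apply: pure_bilinear.
by rewrite -[LHS]tens_lift_pure_id; apply: eq_sw => u v; rewrite !phiK.
Qed.

(** These are the antipode axioms at [A f], pulled back to [f] because [A] respects coproduct and
    counit. *)
Lemma conv_antipode (A : Hom) : coalg_morphism A ->
  conv (antipode \o A) A = unit_counit g a /\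
  conv A (antipode \o A) = unit_counit g a.
Proof.
move=> hA.
have hb1 : bilin (fun u v : env a => antipode u * v).
  exact: (bilin_comp antipode idfun (mul_bilin (env a))).
have hb2 : bilin (fun u v : env a => u * antipode v).
  exact: (bilin_comp idfun antipode (mul_bilin (env a))).
split; apply: linear_ext => X; rewrite /= /conv_fun /unit_counit_fun /= -hA.1.
  by rewrite -sw_antipodel (sw_coalg _ hA hb1).
by rewrite -sw_antipoder (sw_coalg _ hA hb2).
Qed.

End Inverse.

(** * The group axioms for [#] *)

Theorem mainTheorem2 (k : fieldType) (hk : [pchar k] =i pred0)
  (g a : lieAlgType k) (M : rLieModule g a) :
  is_group (@coalg_morphism k g a) (sharp M) (unit_counit g a) /\
  (forall A : {linear env g -> env a}, coalg_morphism A ->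
     exists B : {linear env g -> env a},
       sharp M A B = unit_counit g a /\ sharp M B A = unit_counit g a) /\
  (forall A : {linear env g -> env a}, coalg_morphism A ->
     conv (antipode \o A) A = unit_counit g a /\
     conv A (antipode \o A) = unit_counit g a).
Proof.
have he := coalg_unit_counit g a.
have cl A B : coalg_morphism A -> coalg_morphism B -> coalg_morphism (sharp M A B).
  move=> hA hB; rewrite sharpE //; apply: coalg_conv => //.
  by apply: coalg_comp => //; apply: coalg_twist.
have assoc A B C : coalg_morphism A -> coalg_morphism B -> coalg_morphism C ->
    sharp M A (sharp M B C) = sharp M (sharp M A B) C.
  (* Both sides become the convolution of [A \o twist B \o twist C], [B \o twist C] and [C]. *)
  move=> hA hB hC; rewrite [LHS]sharpE; last exact: cl.
  rewrite [RHS]sharpE // !(sharpE _ _ hB) !(sharpE _ _ hC) twist_conv // convA.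
  by rewrite -conv_precomp; [congr (conv (conv _ _) _); apply: linear_ext|apply: coalg_twist].
have idl A : coalg_morphism A -> sharp M (unit_counit g a) A = A.
  move=> hA; rewrite sharpE //; apply: linear_ext => X; rewrite /= /conv_fun /=.
  rewrite -[RHS](sw_counitl X (linearP A)); apply: eq_sw => u v.
  by rewrite /unit_counit_fun (coalg_twist M hA).1 -scalerAl mul1r.
have idr A : coalg_morphism A -> sharp M A (unit_counit g a) = A.
  move=> hA; rewrite sharpE //; apply: linear_ext => X; rewrite /= /conv_fun /=.
  have tw Y : twist_fun M (unit_counit g a) Y = Y.
    rewrite /twist_fun -[RHS](sw_counitr Y (linearP idfun)); apply: eq_sw => u v.
    by rewrite /= /unit_counit_fun linearZ /= antipode1 linearZr /= act1.
  rewrite -[RHS](sw_counitr X (linearP A)); apply: eq_sw => u v.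
  by rewrite tw /unit_counit_fun -scalerAr mulr1.
have invl A : coalg_morphism A -> exists2 B, coalg_morphism B & sharp M B A = unit_counit g a.
  move=> hA; have [psi [Kpsi psiK]] := twist_bijective M hA.
  have hpsi := coalg_inv (coalg_twist M hA) Kpsi psiK.
  (* This solves [B \o twist A = antipode \o A], so that [B # A] is the convolution of
     [antipode \o A] with [A]. *)
  exists (antipode \o A \o psi).
    by apply: coalg_comp => //; apply: coalg_comp => //; apply: coalg_antipode.
  rewrite sharpE // -(conv_antipode hA).1; congr (conv _ _).
  by apply: linear_ext => X /=; rewrite Kpsi.
have inv A : coalg_morphism A ->
    exists2 B, coalg_morphism B & sharp M A B = unit_counit g a /\ sharp M B A = unit_counit g a.
  (* Left inverses suffice: [B] has a left inverse [C] in turn, and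
     [A = (C # B) # A = C # (B # A) = C]. *)
  move=> hA; have [B hB BA] := invl A hA; have [C hC CB] := invl B hB.
  exists B => //; split=> //.
  have -> : A = C by rewrite -[LHS]idl // -CB -assoc // BA idr.
  exact: CB.
split; first by split=> // A hA; split; [exact: idl|exact: idr].
split; last by move=> A; apply: conv_antipode.
by move=> A /inv [B _ hB]; exists B.
Qed.
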